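(* Let $(Y,\mathbf{X})$ and $(Y',\mathbf{X}')$ be random vectors with $Y,Y'$ real-valued and $\mathbf{X},\mathbf{X}'$ taking values in $\mathbb{R}^p$, $\mathbb{R}^{p'}$, $p,p'\in\mathbb{N}$. The following statements are equivalent: (i) $(Y,\mathbf{X})\preccurlyeq_{ccx}(Y',\mathbf{X}')$; (ii) $\eta_{Y|\mathbf{X}}^v\prec_S\eta_{Y'|\mathbf{X}'}^v$ for Lebesgue-almost all $v\in(0,1)$.
   Context: For a distribution function $G$, $G^{-1}(v)=\inf\{y\mid G(y)\ge v\}$, $v\in(0,1)$; $F_Y$ is the distribution function of $Y$ and $q_Y=F_Y^{-1}$. For bounded random variables, $S\le_{cx}T$ means $\mathbb{E}\varphi(S)\le\mathbb{E}\varphi(T)$ for all convex $\varphi\colon\mathbb{R}\to\mathbb{R}$. Conditional convex order: $(Y,\mathbf{X})\preccurlyeq_{ccx}(Y',\mathbf{X}')$ means $P(Y\ge q_Y(v)\mid\mathbf{X})\le_{cx}P(Y'\ge q_{Y'}(v)\mid\mathbf{X}')$ for all $v\in(0,1)$. The multivariate quantile transform $\mathbf{q}_{\mathbf{X}}\colon(0,1)^p\to\mathbb{R}^p$ is $\mathbf{q}_{\mathbf{X}}(\mathbf{u})=(x_1,\ldots,x_p)$ with $x_1=F_{X_1}^{-1}(u_1)$ and iteratively $x_i=F^{-1}_{X_i|X_{i-1}=x_{i-1},\ldots,X_1=x_1}(u_i)$, $i=2,\ldots,p$; it satisfies $\mathbf{q}_{\mathbf{X}}(\mathbf{U})\stackrel{d}{=}\mathbf{X}$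 for $\mathbf{U}$ uniform on $(0,1)^p$. For $v\in(0,1)$ define $\eta_{Y|\mathbf{X}}^v\colon(0,1)^p\to\mathbb{R}$ by $\eta_{Y|\mathbf{X}}^v(\mathbf{u})=P(Y\le q_Y(v)\mid\mathbf{X}=\mathbf{q}_{\mathbf{X}}(\mathbf{u}))$. The decreasing rearrangement of an integrable $h\colon(0,1)^k\to\mathbb{R}$ is the (Lebesgue-essentially unique) decreasing function $h^*\colon(0,1)\to\mathbb{R}$ with $\lambda(h^*\ge w)=\lambda^k(h\ge w)$ for all $w\in\mathbb{R}$, $\lambda^k$ denoting Lebesgue measure on $(0,1)^k$. For integrable $f\colon(0,1)^d\to\mathbb{R}$, $g\colon(0,1)^{d'}\to\mathbb{R}$ the Schur order $f\prec_S g$ means $\int_0^x f^*(t)\,dt\le\int_0^x g^*(t)\,dt$ for all $x\in(0,1)$ and $\int_0^1 f^*(t)\,dt=\int_0^1 g^*(t)\,dt$. *)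

(* Defs.v *)
From HB Require Import structures.
From mathcomp Require Import all_boot all_order all_algebra.
From mathcomp Require Import all_classical all_reals all_analysis.
From mathcomp Require Import measurable_realfun.

Set Implicit Arguments.
Unset Strict Implicit.
Unset Printing Implicit Defensive.

Import Order.TTheory GRing.Theory Num.Theory.
Import numFieldNormedType.Exports.

Local Open Scope classical_set_scope.
Local Open Scope ring_scope.

(* Only meaningful when [set y | v <= G y] is nonempty and bounded below, as it
   is for a distribution function G and 0 < v < 1. *)
Definition quantile (R : realType) (G : R -> R) (v : R) : R :=
  inf [set y | v <= G y].

Definition RV_quantile d (T : measurableType d) (R : realType)
    (P : probability T R) (Y : {RV P >-> R}) : R -> R :=
  quantile (fun y => fine (cdf Y y)).

(* g is a version of x |-> P(A | X = x), equivalently g \o X is a version of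
   P(A | X); versions agree almost surely under the law of X. *)
Definition is_cond_prob d d' (T : measurableType d) (T' : measurableType d')
    (R : realType) (P : probability T R) (A : set T) (X : T -> T')
    (g : T' -> R) : Prop :=
  [/\ measurable_fun [set: T'] g,
      P.-integrable [set: T] (fun w => (g (X w))%:E) &
      forall B, measurable B ->
        (\int[P]_(w in X @^-1` B) (g (X w))%:E = P (A `&` X @^-1` B))%E].

Lemma is_cond_prob_exists d d' (T : measurableType d) (T' : measurableType d')
    (R : realType) (P : probability T R) (A : set T) (X : {mfun T >-> T'}) :
  measurable A -> exists g, is_cond_prob P A X g.
Proof.
move=> mA.
have mX : measurable_fun [set: T] X by exact: measurable_funPT.
have PAoo : (P A < +oo)%E by rewrite ltey_eq fin_num_measure.
pose PA : {finite_measure set T -> \bar R} := mfrestr mA PAoo.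
pose nu : {charge set T' -> \bar R} :=
  measure_function_pushforward__canonical__charge_Charge
    (charge_of_finite_measure PA) mX.
pose mu : probability T' R := distribution P X.
have mXB B : measurable B -> measurable (X @^-1` B).
  by move=> mB; rewrite -[X in measurable X]setTI; exact: (measurable_funPT X).
have nuE B : nu B = P (A `&` X @^-1` B) by rewrite setIC.
have numu : nu `<< mu.
  apply/null_content_dominatesP => B mB muB0; rewrite nuE.
  by apply: (@subset_measure0 _ _ _ P _ (X @^-1` B)) => //;
    [exact/measurableI/mXB|exact: mXB].
have ffin := @Radon_Nikodym_fin_num _ _ _ nu mu ^~ numu.
have fint := @Radon_Nikodym_integrable _ _ _ nu mu numu.
have fE B := @Radon_Nikodym_integral _ _ _ nu mu B numu.
move: (Radon_Nikodym nu mu) ffin fint fE => f ffin fint fE.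
have mf := measurable_int _ fint.
have fXE : (fun w => (fine (f (X w)))%:E) = f \o X.
  by apply/funext => w; rewrite /= fineK.
have fXint : P.-integrable [set: T] (f \o X).
  apply/integrableP; split.
    move=> _ U mU; rewrite setTI comp_preimage; apply: mXB.
    by rewrite -[X in measurable X]setTI; exact: mf.
  move/integrableP : (fint) => [_]; rewrite ge0_integral_pushforward//.
  exact: measurable_int (integrable_abse fint).
exists (fine \o f); split.
- move=> _ U mU; rewrite comp_preimage; apply: mf => //.
  by rewrite -[X in measurable X]setTI; exact: fine_measurable.
- by rewrite fXE.
- move=> B mB; rewrite -nuE fE// integral_pushforward//.
    by apply: eq_integral => w _; rewrite /= fineK.
  by apply: integrableS fXint => //; exact: mXB.
Qed.

Definition convex_le d d' (T : measurableType d) (T' : measurableType d')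
    (R : realType) (P : probability T R) (P' : probability T' R)
    (S : T -> R) (S' : T' -> R) : Prop :=
  forall phi : R^o -> R^o, convex_function setT phi ->
    ('E_P[phi \o S] <= 'E_P'[phi \o S'])%E.

Definition cond_convex_le d d' d1 d1' (T : measurableType d)
    (T' : measurableType d') (V : measurableType d1) (V' : measurableType d1')
    (R : realType) (P : probability T R) (P' : probability T' R)
    (Y : {RV P >-> R}) (X : {RV P >-> V})
    (Y' : {RV P' >-> R}) (X' : {RV P' >-> V'}) : Prop :=
  forall v : R, 0 < v < 1 ->
  forall (g : V -> R) (g' : V' -> R),
    is_cond_prob P [set w | RV_quantile Y v <= Y w] X g ->
    is_cond_prob P' [set w | RV_quantile Y' v <= Y' w] X' g' ->
    convex_le P P' (g \o X) (g' \o X').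

Section multivariate_quantile_transform.
Context d (T : measurableType d) (R : realType) (P : probability T R).
Context (p : nat) (X : {RV P >-> p.-tuple R}).

Definition coord (i : nat) (w : T) : R := nth 0 (X w) i.

Definition prefix (i : nat) (w : T) : i.-tuple R := [tuple coord j w | j < i].

(* K i is a regular conditional distribution of the coordinate i of X given the
   preceding ones; the prefix of length 0 is constant, so that K 0 [tuple] is the
   law of the first coordinate. *)
Definition is_cond_dist (K : forall i, R.-pker i.-tuple R ~> R) : Prop :=
  forall i, (i < p)%N -> forall B : set R, measurable B ->
    is_cond_prob P (coord i @^-1` B) (prefix i) (fun x => fine (K i x B)).

End multivariate_quantile_transform.

(* The first i coordinates x_1, ..., x_i of q_X(u). *)
Fixpoint mqt_prefix (R : realType) (K : forall i, R.-pker i.-tuple R ~> R)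
    (u : seq R) (i : nat) : i.-tuple R :=
  if i is j.+1 then
    let x := mqt_prefix K u j in
    [tuple of rcons x (quantile (fun y => fine (K j x [set` `]-oo, y]])) (nth 0 u j))]
  else [tuple].

Definition mqt (R : realType) (K : forall i, R.-pker i.-tuple R ~> R)
    (p : nat) (u : p.-tuple R) : p.-tuple R := mqt_prefix K u p.

(* The family g : R -> p.-tuple R -> R consists of versions, for v in (0,1), of
   x |-> P(Y <= q_Y(v) | X = x), so that eta^v is g v \o mqt K. *)
Definition is_cond_cdf_at_quantiles d d1 (T : measurableType d)
    (V : measurableType d1) (R : realType) (P : probability T R)
    (Y : {RV P >-> R}) (X : {RV P >-> V}) (g : R -> V -> R) : Prop :=
  forall v, 0 < v < 1 ->
    is_cond_prob P [set w | Y w <= RV_quantile Y v] X (g v).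

Section schur_order.
Context (R : realType).

Definition tuple_cons_pair k (tx : k.-tuple R * R) : k.+1.-tuple R :=
  [tuple of tx.2 :: tx.1].

Lemma measurable_tuple_cons_pair k :
  measurable_fun [set: k.-tuple R * R] (@tuple_cons_pair k).
Proof. exact: (measurable_cons measurable_snd measurable_fst). Qed.

Definition measure_cons k (m : {measure set (k.-tuple R) -> \bar R}) :
    set (k.+1.-tuple R) -> \bar R :=
  pushforward (m \x @lebesgue_measure R)%E (@tuple_cons_pair k).

Section measure_cons_measure.
Context k (m : {measure set (k.-tuple R) -> \bar R}).

Let mcons := @measurable_tuple_cons_pair k.

Let measure_cons0 : measure_cons m set0 = 0%E.
Proof. by rewrite /measure_cons /pushforward preimage_set0 measure0. Qed.

Let measure_cons_ge0 A : (0 <= measure_cons m A)%E.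
Proof. exact: measure_ge0. Qed.

Let measure_cons_sigma_additive : semi_sigma_additive (measure_cons m).
Proof. exact: (@measure_semi_sigma_additive _ _ _
  (measure_function_pushforward__canonical__measure_function_Measure
    (m \x @lebesgue_measure R)%E mcons)). Qed.

HB.instance Definition _ := isMeasure.Build _ _ _ (measure_cons m)
  measure_cons0 measure_cons_ge0 measure_cons_sigma_additive.

End measure_cons_measure.

Fixpoint lebesgue_tuple (k : nat) : {measure set (k.-tuple R) -> \bar R} :=
  if k is j.+1 then measure_cons (lebesgue_tuple j) else \d_([tuple] : 0.-tuple R).

Definition open_cube (k : nat) : set (k.-tuple R) :=
  [set u | forall i, 0 < tnth u i < 1].

Definition is_decr_rearrangement k (h : k.-tuple R -> R) (hs : R -> R) : Prop :=
  {in `]0, 1[ &, nonincreasing_fun hs} /\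
  forall w : R, lebesgue_measure (`]0, 1[ `&` [set t | w <= hs t]) =
                lebesgue_tuple k (@open_cube k `&` [set u | w <= h u]).

(* The zero function is a dummy value for the case where no rearrangement
   exists. *)
Definition decr_rearrangement k (h : k.-tuple R -> R) : R -> R :=
  xget (fun=> 0) [set hs | is_decr_rearrangement h hs].

Definition schur_le k k' (f : k.-tuple R -> R) (g : k'.-tuple R -> R) : Prop :=
  (forall x : R, 0 < x < 1 ->
    (\int[lebesgue_measure]_(t in `]0%R, x[) (decr_rearrangement f t)%:E <=
     \int[lebesgue_measure]_(t in `]0%R, x[) (decr_rearrangement g t)%:E)%E) /\
  (\int[lebesgue_measure]_(t in `]0%R, 1%R[) (decr_rearrangement f t)%:E =
   \int[lebesgue_measure]_(t in `]0%R, 1%R[) (decr_rearrangement g t)%:E)%E.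

End schur_order.

(* Main.v *)
(* Write A_v = {Y >= q_Y(v)}, B_v = {Y > q_Y(v)}, and let a prime refer to the
   second vector. For variables with values in [0,1], both the convex order of
   S and S' and the Schur order of their decreasing rearrangements amount to
   E|S - c| <= E|S' - c| for all c: convex functions are uniform limits of
   combinations of hinges, and the optimal lower bound
   E|S - c| >= 2 \int_0^x S^* - E S + c (1 - 2x) is attained where S^* crosses c.
   The potentials c |-> E|S - c| depend only on the law and are stable under
   S |-> 1 - S, so, since q_X(U) has the law of X, statement (ii) says that
   P(B_v | X) <=_cx P(B'_v | X') for almost all v, and (i) says the same of A_v
   for all v.
   Conditional probabilities of nested events are at L^1 distance the difference
   of their probabilities, so only probabilities have to converge:
   P(A_w) -> P(B_v) as w decreases to psi(v) = P(Y <= q_Y(v)), and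
   P(B_w) -> P(A_v) as w increases to phi(v) = P(Y < q_Y(v)).
   Equality of means gives phi = phi' under (i), hence psi = psi' off the
   countable set of values of phi and phi' at rationals; under (ii), psi = psi'
   almost everywhere forces phi = phi' everywhere. *)

From Pilot Require Import Defs.
From HB Require Import structures.
From mathcomp Require Import all_boot all_order all_algebra.
From mathcomp Require Import all_classical all_reals all_analysis.
From mathcomp Require Import measurable_realfun.
From mathcomp Require Import ring lra.

Set Implicit Arguments.
Unset Strict Implicit.
Unset Printing Implicit Defensive.

Import Order.TTheory GRing.Theory Num.Theory.
Import numFieldNormedType.Exports.

Local Open Scope classical_set_scope.
Local Open Scope ring_scope.

(** * Quantiles and the uniform law on (0,1) *)

Section cdf_quantile.
Context d (T : measurableType d) (R : realType) (P : probability T R).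
Variable Y : {RV P >-> R}.
Let F y := fine (cdf Y y).

Lemma fine_cdf_nondecreasing : {homo F : x y / x <= y}.
Proof.
move=> x y xy; apply: fine_le; rewrite ?fin_num_measure//.
exact: cdf_nondecreasing.
Qed.

(** The limits of the cdf at -oo and +oo make the set under the infimum bounded below and nonempty;
    right continuity then puts the infimum into the set. *)
Lemma quantile_le v y : 0 < v < 1 -> (RV_quantile Y v <= y) = (v <= F y).
Proof.
move=> /andP[v0 v1].
have hlb : has_lbound [set y | v <= F y].
  have /fine_cvg : (cdf Y @ -oo%R --> 0%:E)%E by exact: cvg_cdfNy0.
  move=> /cvgrPdist_lt /(_ v v0)[M [Mr HM]].
  exists (M - 1) => z /= vz; rewrite leNgt; apply/negP => zM.
  have /= := HM (M - 1); rewrite ltrBlDr ltrDl ltr01 => /(_ isT).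
  rewrite sub0r normrN => H.
  suff : F (M - 1) < v.
    by apply/negP; rewrite -leNgt (le_trans vz)// fine_cdf_nondecreasing// ltW.
  by apply: le_lt_trans H; exact: ler_norm.
have hne : [set y | v <= F y] !=set0.
  have /fine_cvg : (cdf Y @ +oo%R --> 1%:E)%E by exact: cvg_cdfy1.
  move=> /cvgrPdist_lt /(_ (1 - v)); rewrite subr_gt0 => /(_ v1)[M [Mr HM]].
  exists (M + 1) => /=.
  have /= := HM (M + 1); rewrite ltrDl ltr01 => /(_ isT) /ltr_normlW.
  by rewrite ltrD2l ltrN2 => /ltW.
apply/idP/idP => [qy|vy]; last by apply: inf_lbound.
apply: le_trans (fine_cdf_nondecreasing qy).
have : F z @[z --> (RV_quantile Y v)^'+] --> F (RV_quantile Y v).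
  apply: fine_cvg; rewrite fineK ?fin_num_measure//.
  exact: cdf_right_continuous.
move=> cvF.
rewrite -(cvg_lim _ cvF)//; apply: limr_ge; first by apply/cvg_ex; eexists; exact: cvF.
near=> z.
have [s /= vs sz] : exists2 s, v <= F s & s < z.
  by apply: (@inf_lt _ [set y | v <= F y]).
by rewrite (le_trans vs)// fine_cdf_nondecreasing// ltW.
Unshelve. all: by end_near. Qed.

Lemma cdf_quantile_ge v : 0 < v < 1 -> v <= F (RV_quantile Y v).
Proof. by move=> v01; rewrite -quantile_le. Qed.

End cdf_quantile.

Section unif01.
Context (R : realType).

Let m := mrestr (@lebesgue_measure R) (measurable_itv `]0, 1[).

(* [lebesgue_measure] lives on [measurableTypeR R]; [unif01] is a measure on [R]
   itself, the type on which kernels and random variables are defined. *)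
Definition unif01 : set R -> \bar R :=
  fun A => lebesgue_measure (A `&` `]0, 1[).

Let unif01_0 : unif01 set0 = 0%E.
Proof. exact: (measure0 m). Qed.

Let unif01_ge0 A : (0 <= unif01 A)%E.
Proof. exact: (measure_ge0 m). Qed.

Let unif01_sigma_additive : semi_sigma_additive unif01.
Proof. exact: (@measure_semi_sigma_additive _ _ _ m). Qed.

HB.instance Definition _ := isMeasure.Build _ _ _ unif01
  unif01_0 unif01_ge0 unif01_sigma_additive.

Let unif01_setT : unif01 setT = 1%:E.
Proof.
by rewrite /unif01 setTI lebesgue_measure_itv/= lte_fin ltr01 oppr0 adde0.
Qed.

HB.instance Definition _ := Measure_isProbability.Build _ _ R unif01 unif01_setT.

Lemma unif01E A : unif01 A = lebesgue_measure (A `&` `]0, 1[).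
Proof. by []. Qed.

Lemma unif01_le r : 0 <= r <= 1 -> unif01 [set v | v <= r] = r%:E.
Proof.
move=> /andP[r0]; rewrite le_eqVlt => /predU1P[->|r1].
  rewrite unif01E setIidr ?lebesgue_measure_itv/= ?lte_fin ?ltr01 ?oppr0 ?adde0//.
  by move=> x /=; rewrite in_itv/= => /andP[_ /ltW].
rewrite unif01E [X in lebesgue_measure X](_ : _ = `]0, r]%classic).
  rewrite lebesgue_measure_itv/= lte_fin; case: ltgtP r0 => //= [_ _|<- _].
    by rewrite oppr0 adde0.
  by [].
apply/seteqP; split => x /=; rewrite !in_itv/=.
  by move=> [-> /andP[-> _]].
by move=> /andP[-> xr]; rewrite xr (le_lt_trans xr).
Qed.

End unif01.

Section law_on_line.
Context (R : realType).

(** Closed upper rays form a pi-system generating the Borel sets. This form suits decreasing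
    rearrangements, which are prescribed by the measures of the sets [w <= h]. *)
Lemma measure_eq_cray (mu nu : probability R R) :
  (forall r, mu `[r, +oo[%classic = nu `[r, +oo[%classic) ->
  forall A, measurable A -> mu A = nu A.
Proof.
move=> munu A mA; apply: (@measure_unique _ _ _ (@RGenCInfty.G R)
   (fun n => `[- n%:R, +oo[%classic)) => //.
- exact: RGenCInfty.measurableE.
- move=> _ _ [x ->] [y ->]; exists (Num.max x y).
  by apply/seteqP; split => z /=; rewrite !in_itv/= !andbT ge_max => /andP.
- by move=> n; exists (- n%:R).
- rewrite -subTset => x _; exists (Num.truncn `|x|).+1 => //=.
  rewrite in_itv/= andbT; have /andP[_ /ltW h] := truncn_itv (normr_ge0 x).
  by rewrite lerNl (le_trans _ h)// -normrN ler_norm.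
- by move=> _ [x ->]; exact: munu.
- by move=> k; rewrite ltey_eq fin_num_measure.
Qed.

Lemma measure_eq_cdf (mu nu : probability R R) :
  (forall r, mu `]-oo, r]%classic = nu `]-oo, r]%classic) ->
  forall A, measurable A -> mu A = nu A.
Proof.
move=> munu A mA; apply: (@measure_unique _ _ _ (@RGenOInfty.G R)
   (fun n => `]- n%:R, +oo[%classic)) => //.
- exact: RGenOInfty.measurableE.
- move=> _ _ [x ->] [y ->]; exists (Num.max x y).
  by apply/seteqP; split => z /=; rewrite !in_itv/= !andbT gt_max => /andP.
- by move=> n; exists (- n%:R).
- rewrite -subTset => x _; exists (Num.truncn `|x|).+1 => //=.
  rewrite in_itv/= andbT; have /andP[_ h] := truncn_itv (normr_ge0 x).
  by rewrite ltrNl (le_lt_trans _ h)// -normrN ler_norm.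
- move=> _ [x ->]; rewrite -setCitvl.
  by rewrite [LHS](probability_setC mu)// [RHS](probability_setC nu)// munu.
- by move=> k; rewrite ltey_eq fin_num_measure.
Qed.

End law_on_line.

Section kernel_quantile.
Context (R : realType) d (S : measurableType d) (K : R.-pker S ~> R).

Definition kernel_quantile (x : S) (v : R) : R :=
  if 0 < v < 1 then quantile (fun y => fine (K x `]-oo, y]%classic)) v else 0.

Let id_mfun := @isMeasurableFun.Build _ _ R R idfun (@measurable_id _ _ setT).

(** Under [K x] the identity is a random variable with law [K x], which lets [quantile_le] be
    applied to kernels. *)
Let idR : {mfun R >-> R} := HB.pack (idfun : R -> R) id_mfun.

Definition kernel_prob x : set R -> \bar R := K x.

HB.instance Definition _ x := isMeasure.Build _ _ _ (kernel_prob x)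
  (measure0 (K x)) (measure_ge0 (K x)) (@measure_semi_sigma_additive _ _ _ (K x)).

HB.instance Definition _ x :=
  Measure_isProbability.Build _ _ _ (kernel_prob x) (prob_kernel x).

Let Kx x : probability R R := kernel_prob x.

Lemma kernel_quantile_le x v y : 0 < v < 1 ->
  (kernel_quantile x v <= y) = (v <= fine (K x `]-oo, y]%classic)).
Proof.
move=> v01; rewrite /kernel_quantile v01.
exact: (@quantile_le _ _ R (Kx x) (idR : {RV (Kx x) >-> R})).
Qed.

(** At levels in (0,1), [kernel_quantile_le] turns a sublevel set into the comparison
    [v <= K x ]-oo, r]] of two measurable functions of [(x, v)]. *)
Lemma measurable_kernel_quantile :
  measurable_fun setT (fun xv => kernel_quantile xv.1 xv.2).
Proof.
apply: (measurability _ (RGenOInfty.measurableE R)) => _ [_ [r ->] <-].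
rewrite setTI -setCitvl preimage_setC; apply: measurableC.
pose D := [set xv : S * R | 0 < xv.2 < 1].
have mD : measurable D.
  rewrite [D](_ : _ = setT `&` snd @^-1` `]0, 1[); first exact: measurable_snd.
  by rewrite setTI; apply/seteqP; split => x /=; rewrite in_itv.
have mE : measurable [set xv : S * R | xv.2 <= fine (K xv.1 `]-oo, r]%classic)].
  rewrite -[X in measurable X]setTI; apply: measurable_fun_ler => //.
  apply: (measurableT_comp (f := fine)); first exact: fine_measurable.
  apply: (measurableT_comp (f := fun x => K x `]-oo, r]%classic)) => //.
  exact: measurable_kernel.
pose E := [set xv : S * R | xv.2 <= fine (K xv.1 `]-oo, r]%classic)].
(* Off [D] the quantile is the default value 0, which belongs to the sublevel set exactly when
   [0 <= r]. *)
rewrite [X in measurable X](_ : _ =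
  if 0 <= r then ~` D `|` (D `&` E) else D `&` E).
  case: ifP => _; last exact: measurableI.
  by apply: measurableU; [exact: measurableC|exact: measurableI].
apply/seteqP; split => -[x v] /=; rewrite in_itv/=.
  have [vD|/negP vD] := boolP (0 < v < 1); first rewrite kernel_quantile_le//.
    by case: ifP => _ ?; [right|split].
  rewrite /kernel_quantile (negbTE (introN idP vD)) => ->.
  by left.
have [vD|/negP vD] := boolP (0 < v < 1); first rewrite kernel_quantile_le//.
  by case: ifP => _; [case=> [|[]]|case].
rewrite /kernel_quantile (negbTE (introN idP vD)).
by case: ifP => // _; case.
Qed.

(** Inverse transform sampling: the levels sent into []-oo, r]] are those at most [K x ]-oo, r]],
    and their measure is that number. *)
Lemma kernel_quantile_law x B : measurable B ->
  unif01 (kernel_quantile x @^-1` B) = K x B.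
Proof.
have mq : measurable_fun setT (kernel_quantile x).
  exact: measurable_fun_pair2 measurable_kernel_quantile.
pose q : {mfun R >-> R} := HB.pack (kernel_quantile x)
  (@isMeasurableFun.Build _ _ _ _ (kernel_quantile x) mq).
move=> mB; apply: (@measure_eq_cdf R (distribution (@unif01 R) q) (Kx x)) => // r.
rewrite /distribution /pushforward /=.
have K01 : 0 <= fine (K x `]-oo, r]%classic) <= 1.
  rewrite fine_ge0//= -lee_fin fineK; last exact: (fin_num_measure (Kx x)).
  exact: (@probability_le1 _ _ _ (Kx x)).
rewrite -[RHS]fineK; last exact: (fin_num_measure (Kx x)).
rewrite -(unif01_le K01) !unif01E.
congr lebesgue_measure; apply/seteqP; split => v /=; rewrite !in_itv/=.
  by move=> [+ v01]; rewrite kernel_quantile_le.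
by move=> [+ v01]; rewrite kernel_quantile_le.
Qed.

End kernel_quantile.

(** * The uniform law on the open cube *)

Section cube.
Context (R : realType).

Lemma open_cube_cons k (t : k.-tuple R) (x : R) :
  open_cube (tuple_cons_pair (t, x)) <-> 0 < x < 1 /\ open_cube t.
Proof.
split=> [c|[x01 c] i].
  by split=> [|i]; [have := c ord0|have := c (lift ord0 i); rewrite tnthS].
by case: (unliftP ord0 i) => [j ->|->//]; rewrite tnthS; exact: c.
Qed.

Lemma measurable_open_cube k : measurable (@open_cube R k).
Proof.
rewrite (_ : @open_cube R k = \bigcap_(i in [set: 'I_k])
    ((fun u : k.-tuple R => tnth u i) @^-1` `]0, 1[%classic)).
  apply: fin_bigcap_measurable => // i _.
  rewrite -[X in measurable X]setTI; exact: measurable_tnth.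
apply/seteqP; split => u /= h i; last by have := h i I; rewrite /= in_itv.
by move=> _; rewrite /= in_itv/=; exact: h.
Qed.

Definition cube_prob k : set (k.-tuple R) -> \bar R :=
  mrestr (lebesgue_tuple R k) (@measurable_open_cube k).
Arguments cube_prob k : clear implicits.

HB.instance Definition _ k := Measure.on (cube_prob k).

Lemma cube_probE k A : cube_prob k A = lebesgue_tuple R k (@open_cube R k `&` A).
Proof. by rewrite setIC. Qed.

Lemma ge0_integral_cube_prob k (f : k.-tuple R -> \bar R) :
  measurable_fun setT f -> (forall t, 0 <= f t)%E ->
  (\int[cube_prob k]_t f t = \int[lebesgue_tuple R k]_(t in @open_cube R k) f t)%E.
Proof.
move=> mf f0; rewrite (@ge0_negligible_integral _ _ _ _ _ (~` @open_cube R k))//=.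
- rewrite setTD setCK; apply: eq_measure_integral => A mA Ac.
  by rewrite [LHS]cube_probE setIidr.
- by apply: measurableC; exact: measurable_open_cube.
- by rewrite cube_probE setICr measure0.
Qed.

Lemma cube_prob_cons k A : measurable A -> cube_prob k.+1 A =
  (cube_prob k \x @unif01 R)%E (@tuple_cons_pair R k @^-1` A).
Proof.
move=> mA.
have mpA : measurable (@tuple_cons_pair R k @^-1` A).
  by rewrite -[X in measurable X]setTI; exact: measurable_tuple_cons_pair.
rewrite [RHS]ge0_integral_cube_prob//; last exact: measurable_fun_xsection.
rewrite cube_probE /= /measure_cons /pushforward /= /product_measure1 /=.
rewrite [RHS]integral_mkcond; apply: eq_integral => t _.
rewrite patchE !xsectionE /= unif01E; case: ifPn => [/set_mem tc|/negP tc].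
  congr lebesgue_measure; apply/seteqP; split => x /=.
    by move=> [/open_cube_cons[x01 _] At]; split=> //; rewrite in_itv.
  by move=> [Ax]; rewrite in_itv/= => x01; split => //; apply/open_cube_cons.
rewrite (_ : _ @^-1` _ = set0) ?measure0//.
by rewrite -subset0 => x /= [/open_cube_cons[_ /mem_set]].
Qed.

Let cube_prob_setT k : cube_prob k setT = 1%:E.
Proof.
elim: k => [|k ih].
  by rewrite cube_probE setIT /= diracE mem_set// => -[].
rewrite cube_prob_cons// preimage_setT -setXTT product_measure1E//.
by rewrite [X in (X * _)%E]ih mul1e [LHS](probability_setT (@unif01 R)).
Qed.

HB.instance Definition _ k :=
  Measure_isProbability.Build _ _ R (cube_prob k) (cube_prob_setT k).

(** The map [phi] is left abstract so that the formula serves for coordinates added at the front and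
    at the back. *)
Lemma ge0_integral_cube_probS k (phi : k.-tuple R * R -> k.+1.-tuple R) :
  measurable_fun setT phi ->
  (forall A, measurable A ->
    cube_prob k.+1 A = (cube_prob k \x @unif01 R)%E (phi @^-1` A)) ->
  forall f : k.+1.-tuple R -> \bar R,
  measurable_fun setT f -> (forall t, 0 <= f t)%E ->
  (\int[cube_prob k.+1]_t f t =
   \int[cube_prob k]_t \int[@unif01 R]_x f (phi (t, x)))%E.
Proof.
move=> mphi phiE f mf f0.
rewrite (eq_measure_integral
  (pushforward (cube_prob k \x @unif01 R)%E phi)); last first.
  by move=> A mA _; exact: phiE.
rewrite ge0_integral_pushforward// preimage_setT fubini_tonelli1//.
  exact: measurableT_comp.
by move=> x; exact: f0.
Qed.

Definition tuple_rcons_pair k (tx : k.-tuple R * R) : k.+1.-tuple R :=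
  [tuple of rcons tx.1 tx.2].

Lemma measurable_tuple_rcons_pair k :
  measurable_fun [set: k.-tuple R * R] (@tuple_rcons_pair k).
Proof.
apply/measurable_fun_tnthP => i.
have [ik|ki] := ltnP i k.
  rewrite [X in measurable_fun _ X](_ : _ = (fun u => tnth u (Ordinal ik)) \o fst).
    by apply: measurableT_comp => //; exact: measurable_tnth.
  by apply/funext => -[t x]; rewrite /= !(tnth_nth 0)/= nth_rcons size_tuple ik.
rewrite [X in measurable_fun _ X](_ : _ = snd)//.
apply/funext => -[t x]; rewrite /= (tnth_nth 0)/= nth_rcons size_tuple ltnNge ki/=.
by rewrite eqn_leq ki -ltnS ltn_ord.
Qed.

(* [cube_prob] is built by adding coordinates at the front, while the quantile
   transform consumes them from the front and appends at the back: by Tonelli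
   the last coordinate can be integrated first instead. *)
Lemma cube_prob_rcons k A : measurable A -> cube_prob k.+1 A =
  (cube_prob k \x @unif01 R)%E (@tuple_rcons_pair k @^-1` A).
Proof.
elim: k A => [|k ih] A mA.
  rewrite cube_prob_cons//; congr product_measure1.
  apply/funext => -[t x]; rewrite /preimage /=; congr A.
  by rewrite (tuple0 t); exact/val_inj.
have mc := @measurable_tuple_cons_pair R.
have mr := @measurable_tuple_rcons_pair.
have mcA : measurable (@tuple_cons_pair R k.+1 @^-1` A).
  by rewrite -[X in measurable X]setTI; exact: mc.
have mrA : measurable (@tuple_rcons_pair k.+1 @^-1` A).
  by rewrite -[X in measurable X]setTI; exact: mr.
pose f1 t := unif01 (xsection (@tuple_cons_pair R k.+1 @^-1` A) t).
pose f2 t := unif01 (xsection (@tuple_rcons_pair k.+1 @^-1` A) t).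
have mf1 : measurable_fun setT f1 by exact: measurable_fun_xsection.
have mf2 : measurable_fun setT f2 by exact: measurable_fun_xsection.
have f1_ge0 t : (0 <= f1 t)%E by exact: measure_ge0.
have f2_ge0 t : (0 <= f2 t)%E by exact: measure_ge0.
(* The last coordinate is detached on one side by the induction hypothesis and the first on the
   other, so that both sides become integrals over the same [k] middle coordinates. *)
have e1 := ge0_integral_cube_probS (mr k) ih mf1 f1_ge0.
have e2 := ge0_integral_cube_probS (mc k) (@cube_prob_cons k) mf2 f2_ge0.
rewrite cube_prob_cons//; apply: (etrans e1); apply: (etrans _ (esym e2)).
rewrite /f1 /f2 {mf1 mf2 f1_ge0 f2_ge0 e1 e2 f1 f2}.
apply: eq_integral => t _.
(* With the middle coordinates [t] fixed, [yx.1] is the last coordinate and [yx.2] the first; the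
   two iterated integrals over [B] agree by uniqueness of the product measure. *)
pose B := [set yx : R * R | A (tuple_cons_pair (tuple_rcons_pair (t, yx.1), yx.2))].
have mB : measurable B.
  have mt : measurable_fun setT (fun yx : R * R => tuple_rcons_pair (t, yx.1)).
    exact: measurableT_comp (mr k)
      (measurable_fun_pair (measurable_cst t) measurable_fst).
  rewrite -[B]setTI; apply: (measurableT_comp (mc k.+1)) => //.
  exact: measurable_fun_pair mt measurable_snd.
transitivity ((@unif01 R \x @unif01 R)%E B).
  by apply: eq_integral => y _ /=; rewrite !xsectionE.
rewrite (@product_measure_unique _ _ _ _ _ (@unif01 R) (@unif01 R)
  (@unif01 R \x^ @unif01 R)%E)//; last first.
  by move=> *; rewrite [LHS]product_measure2E.
apply: eq_integral => x _ /=; rewrite ysectionE xsectionE.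
congr unif01; apply/seteqP; split => y; rewrite /B /=.
  by congr A; exact/val_inj.
by congr A; exact/val_inj.
Qed.

End cube.
Arguments cube_prob R k : clear implicits.

(** * The law of the multivariate quantile transform *)

Section disintegration.
Context d d' (T : measurableType d) (S : measurableType d') (R : realType).

Section kernel_product.
Context (nu : probability S R) (K : R.-pker S ~> R).

(** The joint law of a pair whose first component has law [nu] and whose second has conditional law
    [K] given the first. *)
Definition kernel_product (D : set (S * R)) : \bar R :=
  (\int[nu]_x K x (xsection D x))%E.

Lemma measurable_kernel_xsection (D : set (S * R)) : measurable D ->
  measurable_fun setT (fun x => K x (xsection D x)).
Proof. by move=> mD; exact: (measurable_fun_xsection_finite_kernel K (mem_set mD)). Qed.

Let kernel_product0 : kernel_product set0 = 0%E.
Proof. by rewrite /kernel_product integral0_eq// => x _; rewrite xsection0. Qed.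

Let kernel_product_ge0 D : (0 <= kernel_product D)%E.
Proof. by apply: integral_ge0 => x _; exact: measure_ge0. Qed.

Let kernel_product_sigma_additive : semi_sigma_additive kernel_product.
Proof.
move=> F mF tF mUF.
rewrite [X in _ --> X](_ : _ = (\sum_(n <oo) kernel_product (F n))%E).
  by apply/cvg_closeP; split; [exact: is_cvg_nneseries|rewrite closeE].
rewrite -integral_nneseries//; last by move=> n; exact: measurable_kernel_xsection.
apply: eq_integral => x _; apply/esym/cvg_lim => //=; rewrite xsection_bigcup.
apply: (measure_sigma_additive _ (trivIset_xsection tF)) => ?.
exact: measurable_xsection.
Qed.

HB.instance Definition _ := isMeasure.Build _ _ _ kernel_product
  kernel_product0 kernel_product_ge0 kernel_product_sigma_additive.

Lemma kernel_productX A B : measurable A -> measurable B ->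
  kernel_product (A `*` B) = (\int[nu]_(x in A) K x B)%E.
Proof.
move=> mA mB; rewrite /kernel_product [RHS]integral_mkcond.
apply: eq_integral => x _; rewrite patchE; case: ifPn => xA.
  by rewrite in_xsectionX.
by rewrite notin_xsectionX// measure0.
Qed.

End kernel_product.

(** As functions of [D] both sides are finite measures. They agree on rectangles by the defining
    property of conditional probabilities, and rectangles form a generating pi-system. *)
Lemma cond_dist_disintegration (P : probability T R) (Z : {mfun T >-> S})
    (W : {mfun T >-> R}) (K : R.-pker S ~> R) :
  (forall B, measurable B ->
    is_cond_prob P (W @^-1` B) Z (fun x => fine (K x B))) ->
  forall D : set (S * R), measurable D ->
  (\int[P]_w K (Z w) (xsection D (Z w)))%E = P [set w | D (Z w, W w)].
Proof.
move=> hK D mD.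
have mKx B : measurable B -> measurable_fun setT (fun x => K x B).
  exact: measurable_kernel.
rewrite -(@ge0_integral_distribution _ _ _ _ _ P (Z : {RV P >-> S})
  (fun x => K x (xsection D x)))//; last first.
  exact: measurable_kernel_xsection.
have mZW : measurable_fun setT (fun w => (Z w, W w)).
  by apply/measurable_fun_pairP; split; exact: measurable_funPT.
pose ZW : {mfun T >-> (S * R)%type} := HB.pack (fun w => (Z w, W w))
  (@isMeasurableFun.Build _ _ _ _ (fun w => (Z w, W w)) mZW).
apply: (@measure_unique _ _ _
  [set C | exists A, measurable A /\ exists B, measurable B /\ C = A `*` B]
  (fun=> setT) _ _ _ _ (kernel_product (distribution P Z) K) (distribution P ZW)) => //.
- rewrite measurable_prod_measurableType //; congr (<<s _ >>).
  rewrite predeqE; split => [[A mA [B mB <-]]|[A [mA [B [mB ->]]]]].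
    by exists A; split => //; exists B.
  by exists A => //; exists B.
- move=> _ _ [X1 [mX1 [X2 [mX2 ->]]]] [Y1 [mY1 [Y2 [mY2 ->]]]].
  rewrite -setXI; exists (X1 `&` Y1); split; first exact: measurableI.
  by exists (X2 `&` Y2); split => //; exact: measurableI.
- by move=> _; exists setT; split => //; exists setT; split => //; rewrite setXTT.
- by rewrite bigcup_const.
- move=> _ [A [mA [B [mB ->]]]]; rewrite [LHS]kernel_productX//.
  rewrite ge0_integral_pushforward//; last first.
    by apply: measurable_funTS; exact: mKx.
  have [_ _ /(_ A mA) h] := hK B mB.
  transitivity (\int[P]_(w in Z @^-1` A) (fine (K (Z w) B))%:E)%E.
    apply: eq_integral => w _ /=; rewrite fineK//.
    exact: (fin_num_measure (kernel_prob K (Z w))).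
  by rewrite h /distribution /pushforward setIC.
- move=> _; rewrite /= /kernel_product.
  under eq_integral do rewrite -setXTT in_xsectionX ?inE// prob_kernel.
  by rewrite integral_cst// [X in (_ * X)%E]probability_setT mule1 ltry.
Qed.

End disintegration.

Section quantile_transform_law.
Context (R : realType) (K : forall i, R.-pker i.-tuple R ~> R).

(* [mqt_prefix] with quantiles at levels outside (0,1), where they are junk,
   replaced by 0: measurable everywhere and unchanged on the open cube. *)
Fixpoint mqt_prefix0 (u : seq R) (i : nat) : i.-tuple R :=
  if i is j.+1 then
    let x := mqt_prefix0 u j in
    tuple_rcons_pair (x, kernel_quantile (K j) x (nth 0 u j))
  else [tuple].

Lemma mqt_prefix0E k (u : k.-tuple R) i : (i <= k)%N -> open_cube u ->
  mqt_prefix K u i = mqt_prefix0 u i.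
Proof.
move=> + cu; elim: i => //= i ih ik; rewrite ih; last exact: ltnW.
rewrite /kernel_quantile ifT; first exact: val_inj.
by have := cu (Ordinal ik); rewrite (tnth_nth 0).
Qed.

Lemma mqt_prefix0_rcons (t : seq R) y i : (i <= size t)%N ->
  mqt_prefix0 (rcons t y) i = mqt_prefix0 t i.
Proof. by elim: i => //= i ih it; rewrite ih ?nth_rcons ?it// ltnW. Qed.

Lemma measurable_mqt_prefix0 k i : (i <= k)%N ->
  measurable_fun setT (fun u : k.-tuple R => mqt_prefix0 u i).
Proof.
elim: i => [_|i ih ik]; first exact: measurable_cst.
have mi := ih (ltnW ik).
have mn : measurable_fun setT (fun u : k.-tuple R => nth 0 u i).
  rewrite [X in measurable_fun _ X](_ : _ = (fun u => tnth u (Ordinal ik))).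
    exact: measurable_tnth.
  by apply/funext => u; rewrite (tnth_nth 0).
have mq := measurableT_comp (measurable_kernel_quantile (K i))
  (measurable_fun_pair mi mn).
exact: (measurableT_comp (@measurable_tuple_rcons_pair R i)
  (measurable_fun_pair mi mq)).
Qed.

Context d (T : measurableType d) (P : probability T R).
Context (p : nat) (X : {RV P >-> p.-tuple R}).

Lemma measurable_coord i : (i < p)%N -> measurable_fun setT (Defs.coord X i).
Proof.
move=> ip.
rewrite [Y in measurable_fun _ Y](_ : _ =
  (fun u : p.-tuple R => tnth u (Ordinal ip)) \o X).
  by apply: measurableT_comp => //; exact: measurable_tnth.
by apply/funext => w; rewrite /= (tnth_nth 0).
Qed.

Lemma measurable_prefix i : (i <= p)%N -> measurable_fun setT (Defs.prefix X i).
Proof.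
move=> ip; apply/measurable_fun_tnthP => j.
rewrite [Y in measurable_fun _ Y](_ : _ = Defs.coord X j).
  by apply: measurable_coord; exact: leq_trans ip.
by apply/funext => w; rewrite /= tnth_mktuple.
Qed.

Lemma prefixS i w :
  Defs.prefix X i.+1 w = tuple_rcons_pair (Defs.prefix X i w, Defs.coord X i w).
Proof.
apply: eq_from_tnth => j; rewrite tnth_mktuple (tnth_nth 0)/=.
rewrite nth_rcons size_tuple card_ord.
case: ltnP => [ji|ij]; first last.
  have -> : j = i :> nat by apply/eqP; rewrite eqn_leq ij -ltnS ltn_ord.
  by rewrite eqxx.
by have := tnth_mktuple (fun j : 'I_i => Defs.coord X j w) (Ordinal ji);
  rewrite (tnth_nth 0) => ->.
Qed.

Lemma prefix_id w : Defs.prefix X p w = X w.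
Proof.
by apply: eq_from_tnth => j; rewrite tnth_mktuple /Defs.coord (tnth_nth 0).
Qed.

Hypothesis hK : is_cond_dist X K.

(** Induction on [i]: integrating the last level first replaces the quantile by the kernel [K i],
    the induction hypothesis replaces the transformed levels by the prefix of [X], and
    disintegration recovers the law of the longer prefix. *)
Lemma mqt_prefix0_law i C : (i <= p)%N -> measurable C ->
  cube_prob R i [set u | C (mqt_prefix0 u i)] = P (Defs.prefix X i @^-1` C).
Proof.
elim: i C => [|i ih] C ip mC.
  have [C0|C0] := pselect (C [tuple]).
    rewrite [X in cube_prob R 0 X](_ : _ = setT) ?[LHS]probability_setT; last first.
      by rewrite -subTset.
    rewrite [X in P X](_ : _ = setT) ?probability_setT//.
    by rewrite -subTset => w _ /=; rewrite (tuple0 (Defs.prefix _ _ _)).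
  rewrite [X in cube_prob R 0 X](_ : _ = set0) ?measure0; last first.
    by rewrite -subset0.
  rewrite [X in P X](_ : _ = set0) ?measure0//.
  by rewrite -subset0 => w /=; rewrite (tuple0 (Defs.prefix _ _ _)).
pose D := @tuple_rcons_pair R i @^-1` C.
have mD : measurable D.
  by rewrite -[D]setTI; exact: measurable_tuple_rcons_pair.
have mF : measurable_fun setT (fun x => K i x (xsection D x)).
  exact: measurable_kernel_xsection.
rewrite cube_prob_rcons; last first.
  by rewrite -[X in measurable X]setTI; exact: (measurable_mqt_prefix0 (leqnn i.+1)).
transitivity (\int[cube_prob R i]_t
    K i (mqt_prefix0 t i) (xsection D (mqt_prefix0 t i)))%E.
  apply: eq_integral => t _ /=.
  rewrite -kernel_quantile_law; last exact: measurable_xsection.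
  congr unif01; apply/seteqP; split => y; rewrite !xsectionE /D /=;
    by rewrite mqt_prefix0_rcons ?size_tuple// nth_rcons size_tuple ltnn eqxx.
have mq := measurable_mqt_prefix0 (leqnn i).
have mp := measurable_prefix (ltnW ip).
pose Z : {mfun T >-> i.-tuple R} := HB.pack (Defs.prefix X i)
  (@isMeasurableFun.Build _ _ _ _ (Defs.prefix X i) mp).
pose W : {mfun T >-> R} := HB.pack (Defs.coord X i)
  (@isMeasurableFun.Build _ _ _ _ (Defs.coord X i) (measurable_coord ip)).
rewrite -(@ge0_integral_pushforward _ _ _ _ _ _ mq (cube_prob R i) setT
  (fun x => K i x (xsection D x)))//.
rewrite (eq_measure_integral (distribution P Z)); last first.
  by move=> A mA _; exact: ih (ltnW ip) mA.
rewrite ge0_integral_pushforward// preimage_setT.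
rewrite (cond_dist_disintegration (Z := Z) (W := W) (hK ip) mD).
by congr (P _); apply/seteqP; split => w /=; rewrite prefixS.
Qed.

Lemma mqt_law C : measurable C ->
  lebesgue_tuple R p (@open_cube R p `&` [set u | C (mqt K u)]) = P (X @^-1` C).
Proof.
move=> mC; have := mqt_prefix0_law (leqnn p) mC.
rewrite cube_probE.
rewrite (_ : open_cube (k:=p) `&` _ = open_cube (k:=p) `&` [set u | C (mqt K u)]).
  by move=> ->; congr (P _); apply/funext => w /=; rewrite /preimage /= prefix_id.
by apply/seteqP; split => u /= [cu]; rewrite /mqt mqt_prefix0E.
Qed.

End quantile_transform_law.

(** * Conditional probabilities of nested events *)

Section conditional_probability.
Context d d' (T : measurableType d) (V : measurableType d') (R : realType).
Context (P : probability T R) (X : T -> V) (mX : measurable_fun setT X).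

Lemma bounded_measurable_integrable (S : T -> R) (M : R) :
  measurable_fun setT S -> (forall w, `|S w| <= M) ->
  P.-integrable setT (EFin \o S).
Proof.
move=> mS SM; apply: measurable_bounded_integrable => //.
  by rewrite ltey_eq fin_num_measure.
exists M; split; first exact: num_real.
by move=> z Mz w _ /=; exact: le_trans (SM w) (ltW Mz).
Qed.

Lemma is_cond_prob_measurable A g :
  is_cond_prob P A X g -> measurable_fun setT (g \o X).
Proof. by move=> [mg _ _]; exact: measurableT_comp. Qed.

Lemma is_cond_prob_set0 : is_cond_prob P set0 X (fun=> 0).
Proof.
split; [exact: measurable_cst|exact: integrable0|].
by move=> B mB; rewrite set0I measure0 integral0.
Qed.

Lemma is_cond_probC A g : measurable A -> is_cond_prob P A X g ->
  is_cond_prob P (~` A) X (fun x => 1 - g x).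
Proof.
move=> mA [mg ig hg]; have i1 : P.-integrable setT (cst 1%:E : T -> \bar R).
  exact: finite_measure_integrable_cst.
split; [exact: measurable_funB|exact: (integrableB measurableT i1 ig)|].
move=> B mB.
have mXB : measurable (X @^-1` B) by rewrite -[X in measurable X]setTI; exact: mX.
rewrite (integralB mXB (integrableS measurableT mXB (@subsetT _ _) i1)
  (integrableS measurableT mXB (@subsetT _ _) ig)).
rewrite hg// integral_cst// mul1e (setIC (~` A)) -setDE measureD//; last first.
  by rewrite ltey_eq fin_num_measure.
by rewrite setIC.
Qed.

Lemma is_cond_prob_setT : is_cond_prob P setT X (fun=> 1).
Proof.
have := is_cond_probC measurable0 is_cond_prob_set0.
by rewrite setC0; under eq_fun do rewrite subr0.
Qed.

(** On the event that [X] falls in [N], where [g < f], the integral of [f - g] is a difference of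
    probabilities that is at most 0; its integrand being positive there, the event is null. *)
Lemma is_cond_prob_le A B f g : measurable A -> measurable B -> A `<=` B ->
  is_cond_prob P A X f -> is_cond_prob P B X g ->
  {ae P, forall w, f (X w) <= g (X w)}.
Proof.
move=> mA mB AB [mf if_ hf] [mg ig hg].
pose N := [set x | g x < f x].
have mN : measurable N by rewrite -[N]setTI; exact: measurable_fun_ltr.
have mXN : measurable (X @^-1` N) by rewrite -[X in measurable X]setTI; exact: mX.
have ifg : P.-integrable (X @^-1` N) (fun w => (f (X w) - g (X w))%:E).
  by apply: (@integrableS _ _ _ _ setT) => //; exact: (integrableB measurableT if_ ig).
have : (\int[P]_(w in X @^-1` N) `|(f (X w) - g (X w))%:E| = 0)%E.
  apply/eqP; rewrite eq_le; apply/andP; split; last exact: integral_ge0.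
  rewrite (eq_integral (fun w => (f (X w) - g (X w))%:E)); last first.
    by move=> w /set_mem Nw; rewrite gee0_abs// lee_fin subr_ge0; exact: ltW.
  rewrite (integralB mXN (integrableS measurableT mXN (@subsetT _ _) if_)
    (integrableS measurableT mXN (@subsetT _ _) ig)).
  rewrite hf// hg// sube_le0; apply: le_measure; rewrite ?inE; try exact: measurableI.
  exact: setSI.
move=> /(ae_eq_integral_abs P mXN (measurable_int _ ifg)).
apply: filterS => w h; rewrite leNgt; apply/negP => Nw.
have [/eqP] := h Nw; rewrite subr_eq0 => /eqP fg.
by move: Nw; rewrite fg ltxx.
Qed.

(** Versions lie in [0,1] only almost surely; clipping makes the bounds hold pointwise, as the
    lemmas on potentials require. *)
Definition clip01 (x : R) : R := Num.max 0 (Num.min 1 x).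

Lemma clip01_ge0 x : 0 <= clip01 x. Proof. by rewrite le_max lexx. Qed.

Lemma clip01_le1 x : clip01 x <= 1.
Proof. by rewrite ge_max ler01 ge_min lexx. Qed.

(** Comparison with the versions 0 of the empty event and 1 of the full event shows that clipping
    changes [g] only on a null set. *)
Lemma is_cond_prob_clip A g : measurable A -> is_cond_prob P A X g ->
  is_cond_prob P A X (clip01 \o g) /\ {ae P, forall w, clip01 (g (X w)) = g (X w)}.
Proof.
move=> mA hg.
have ae_eq : {ae P, forall w, clip01 (g (X w)) = g (X w)}.
  have h0 := is_cond_prob_le measurable0 mA (@sub0set _ _) is_cond_prob_set0 hg.
  have h1 := is_cond_prob_le mA measurableT (@subsetT _ _) hg is_cond_prob_setT.
  apply: filterS2 h0 h1 => w g0 g1.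
  by rewrite /clip01 (min_idPr g1) (max_idPr g0).
split => //; case: hg => [mg ig hg].
have mc : measurable_fun setT (clip01 \o g).
  by apply: measurable_maxr => //; exact: measurable_minr.
split => //.
  apply: (@bounded_measurable_integrable (clip01 \o g \o X) 1).
    exact: measurableT_comp.
  by move=> w; rewrite ger0_norm ?clip01_ge0 ?clip01_le1.
move=> B mB; rewrite -hg//.
have mXB : measurable (X @^-1` B) by rewrite -[X in measurable X]setTI; exact: mX.
apply: ae_eq_integral => //.
- by apply/measurable_EFinP/measurable_funTS/measurableT_comp.
- by apply/measurable_EFinP/measurable_funTS/measurableT_comp.
- by apply: filterS ae_eq => w h _ /=; rewrite h.
Qed.

Lemma is_cond_prob_mean A g : is_cond_prob P A X g ->
  \int[P]_w g (X w) = fine (P A).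
Proof.
by move=> [_ _ /(_ setT measurableT)]; rewrite preimage_setT setIT /Rintegral => ->.
Qed.

(** For nested events the difference of the versions has a constant sign almost surely, so its
    absolute value integrates to the difference of the means. *)
Lemma is_cond_prob_dist A B f g : measurable A -> measurable B -> A `<=` B ->
  is_cond_prob P A X f -> is_cond_prob P B X g ->
  \int[P]_w `|g (X w) - f (X w)| = fine (P B) - fine (P A).
Proof.
move=> mA mB AB hf hg.
have [mf if_ _] := hf; have [mg ig _] := hg.
rewrite -(is_cond_prob_mean hf) -(is_cond_prob_mean hg) -RintegralB//.
congr fine; apply: ae_eq_integral => //.
- apply/measurable_EFinP/measurableT_comp => //.
  by apply: measurable_funB; exact: measurableT_comp.
- by apply/measurable_EFinP/measurable_funB; exact: measurableT_comp.
- apply: filterS (is_cond_prob_le mA mB AB hf hg) => w h _.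
  by rewrite ger0_norm// subr_ge0.
Qed.

End conditional_probability.

(** * Schur order and potentials *)

Section schur_potential.
Context (R : realType).
Local Notation mu := (@lebesgue_measure R).

Section split.
Context (h : R -> R) (c x : R).
Hypothesis mh : measurable_fun (`]0, 1[%classic : set (measurableTypeR R)) h.
Hypothesis h01 : forall t, 0 < t < 1 -> 0 <= h t <= 1.
Hypothesis x01 : 0 <= x <= 1.

Local Notation I01 := (`]0, 1[%classic : set (measurableTypeR R)).

Let mI : measurable I01. Proof. exact: measurable_itv. Qed.

Let int_bounded (f : measurableTypeR R -> R) (M : R) : measurable_fun I01 f ->
  (forall t, 0 < t < 1 -> `|f t| <= M) -> mu.-integrable I01 (EFin \o f).
Proof.
move=> mf fM; apply: measurable_bounded_integrable => //.
  by rewrite [X in (X < _)%E]lebesgue_measure_itv/= lte_fin ltr01 oppr0 adde0 ltry.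
exists M; split; first exact: num_real.
move=> z Mz t; rewrite /= in_itv/= => t01; exact: le_trans (fM _ t01) (ltW Mz).
Qed.

Let h_le1 t : 0 < t < 1 -> `|h t| <= 1.
Proof. by move=> /h01 /andP[h0 h1]; rewrite ger0_norm. Qed.

Let int_h : mu.-integrable I01 (EFin \o h).
Proof. exact: (@int_bounded _ 1). Qed.

Let mIlt : measurable ([set t | t < x] : set (measurableTypeR R)).
Proof.
rewrite (_ : mkset _ = `]-oo, x[%classic); first exact: measurable_itv.
by apply/seteqP; split => t /=; rewrite in_itv.
Qed.

Let Ix : I01 `&` [set t | t < x] = `]0, x[%classic.
Proof.
apply/seteqP; split => t /=; rewrite !in_itv/=; first by move=> [/andP[-> _] ->].
move=> /andP[-> tx]; split => //=; rewrite (lt_le_trans tx)//.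
by case/andP: x01.
Qed.

(** Whatever the cut [x], [sgn t * (h t - c)] is at most [|h t - c|], with equality off [x] when [h]
    crosses the level [c] at [x]. *)
Let sgn (t : measurableTypeR R) : R := if t < x then 1 else -1.

Let sgn_hc t : sgn t * (h t - c) = 2 * (h \_ [set t | t < x]) t - h t +
   (c - 2 * c * \1_[set t | t < x] t).
Proof.
rewrite /sgn patchE indicE; case: ltP => tx.
  by rewrite mem_set//=; lra.
rewrite memNset/=; last by apply/negP; rewrite -leNgt.
by rewrite (_ : point = 0 :> R)//; lra.
Qed.

Let int_hx : mu.-integrable I01 (EFin \o (h \_ [set t | t < x])).
Proof.
apply: (@int_bounded _ 1).
  apply/(measurable_restrict _ mIlt mI).
  by apply: measurable_funS mh => //; exact: subIsetl.
by move=> t t01; rewrite patchE; case: ifP => _; [exact: h_le1|rewrite normr0].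
Qed.

Let int_1x : mu.-integrable I01 (EFin \o (\1_[set t | t < x] : measurableTypeR R -> R)).
Proof.
apply: (@int_bounded _ 1); first exact: measurable_indic.
by move=> t t01; rewrite indicE; case: (_ \in _); rewrite ?normr1// normr0.
Qed.

Let Rint_1x : \int[mu]_(t in I01) \1_[set t | t < x] t = x.
Proof.
have /andP[x0 x1] := x01.
rewrite /Rintegral integral_indic// setIC Ix [X in fine X]lebesgue_measure_itv/= lte_fin.
case: ifPn => [_|]; first by rewrite oppr0 adde0.
by rewrite -leNgt => x0' /=; apply/eqP; rewrite eq_le x0 x0'.
Qed.

Let Rint_cst r : \int[mu]_(t in I01) r = r.
Proof.
by rewrite Rintegral_cst// [X in fine X]lebesgue_measure_itv/= lte_fin ltr01 oppr0 adde0 mulr1.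
Qed.

Let int_cst r : mu.-integrable I01 (EFin \o cst r).
Proof. exact: (@int_bounded _ `|r|). Qed.

Let Rintegral_sgn : \int[mu]_(t in I01) (sgn t * (h t - c)) =
  2 * \int[mu]_(t in `]0, x[) h t - \int[mu]_(t in `]0, 1[) h t + c * (1 - 2 * x).
Proof.
under eq_Rintegral do rewrite sgn_hc.
have i1 : mu.-integrable I01 (EFin \o (fun t => 2 * (h \_ [set t | t < x]) t)).
  exact: (integrableZl mI 2 int_hx).
have i2 : mu.-integrable I01 (EFin \o (fun t => (2 * c) * \1_[set t | t < x] t)).
  exact: (integrableZl mI (2 * c) int_1x).
have i3 : mu.-integrable I01 (EFin \o
    (fun t => 2 * (h \_ [set t | t < x]) t - h t)).
  exact: (integrableB mI i1 int_h).
have i4 : mu.-integrable I01 (EFin \o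
    (fun t => c - 2 * c * \1_[set t | t < x] t)).
  exact: (integrableB mI (int_cst c) i2).
rewrite (RintegralD mI i3 i4) (RintegralB mI i1 int_h).
rewrite (RintegralB mI (int_cst c) i2) (RintegralZl 2 mI int_hx).
rewrite (RintegralZl (2 * c) mI int_1x) Rint_1x Rint_cst -Rintegral_mkcondr Ix.
by rewrite mulrBr mulr1; congr (_ + (_ - _)); lra.
Qed.

Let int_sgn : mu.-integrable I01 (EFin \o (fun t => sgn t * (h t - c))).
Proof.
rewrite (_ : EFin \o _ = fun t => (2 * (h \_ [set t | t < x]) t - h t +
    (c - 2 * c * \1_[set t | t < x] t))%:E); last first.
  by apply/funext => t; exact: (congr1 EFin (sgn_hc t)).
apply: (integrableD mI (f := fun t => (2 * (h \_ [set t | t < x]) t - h t)%:E)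
   (g := fun t => (c - 2 * c * \1_[set t | t < x] t)%:E)).
  exact: (integrableB mI (integrableZl mI 2 int_hx) int_h).
exact: (integrableB mI (int_cst c) (integrableZl mI (2 * c) int_1x)).
Qed.

Let int_hc : mu.-integrable I01 (EFin \o (fun t => `|h t - c|)).
Proof.
exact: (integrable_norm (integrableB mI int_h (int_cst c))).
Qed.

Lemma split_le_potential :
  2 * \int[mu]_(t in `]0, x[) h t - \int[mu]_(t in `]0, 1[) h t + c * (1 - 2 * x)
  <= \int[mu]_(t in `]0, 1[) `|h t - c|.
Proof.
rewrite -Rintegral_sgn; apply: le_Rintegral => // t _.
by rewrite /sgn; case: ifP => _; rewrite ?mul1r ?mulN1r ?ler_norm// -normrN ler_norm.
Qed.

Lemma split_eq_potential :
  (forall t, 0 < t < 1 -> t < x -> c <= h t) ->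
  (forall t, 0 < t < 1 -> x < t -> h t <= c) ->
  \int[mu]_(t in `]0, 1[) `|h t - c| =
  2 * \int[mu]_(t in `]0, x[) h t - \int[mu]_(t in `]0, 1[) h t + c * (1 - 2 * x).
Proof.
move=> hl hr; rewrite -Rintegral_sgn; congr fine; apply: ae_eq_integral => //.
- exact: measurable_int int_hc.
- exact: measurable_int int_sgn.
- exists [set x]; split => //; first exact: lebesgue_measure_set1.
  move=> t /=; apply: contra_notP => /eqP tx /=; rewrite in_itv/= => t01.
  rewrite /sgn; congr EFin; case: ltgtP tx => // tx _.
    by rewrite mul1r ger0_norm// subr_ge0 hl.
  by rewrite mulN1r ler0_norm// subr_le0 hr.
Qed.

End split.

(* The maximum over [x] of the lower bounds of [split_le_potential] is attained
   where [h] crosses the level [c]; hence Schur order of decreasing functions is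
   comparison of the potentials [c |-> \int |h - c|]. *)
Lemma schur_le_potentialP (h h' : R -> R) :
  {in `]0, 1[ &, nonincreasing_fun h} -> {in `]0, 1[ &, nonincreasing_fun h'} ->
  (forall t, 0 < t < 1 -> 0 <= h t <= 1) ->
  (forall t, 0 < t < 1 -> 0 <= h' t <= 1) ->
  measurable_fun (`]0, 1[%classic : set (measurableTypeR R)) h ->
  measurable_fun (`]0, 1[%classic : set (measurableTypeR R)) h' ->
  ((forall x, 0 < x < 1 ->
     \int[mu]_(t in `]0, x[) h t <= \int[mu]_(t in `]0, x[) h' t) /\
   \int[mu]_(t in `]0, 1[) h t = \int[mu]_(t in `]0, 1[) h' t) <->
  (forall c, \int[mu]_(t in `]0, 1[) `|h t - c| <=
             \int[mu]_(t in `]0, 1[) `|h' t - c|).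
Proof.
move=> nh nh' h01 h'01 mh mh'; split=> [[le_h eq_h] c|le_pot].
(* The crossing point of [h] with the level [c] is [sup U]; if [U] is empty the convention
   [sup set0 = 0] gives the right cut. *)
- pose U := [set t | 0 < t < 1 /\ c <= h t].
  have U1 : ubound U 1 by move=> t [/andP[_ /ltW]].
  have hsU : has_ubound U by exists 1.
  have x0 : 0 <= sup U.
    have [->|/set0P[u Uu]] := eqVneq U set0; first by rewrite sup0.
    by have [/andP[/ltW u0 _] _] := Uu; exact: le_trans u0 (ub_le_sup hsU Uu).
  have x1 : sup U <= 1.
    have [->|/set0P U0] := eqVneq U set0; first by rewrite sup0.
    exact: ge_sup.
  have x01 : 0 <= sup U <= 1 by rewrite x0.
  rewrite (split_eq_potential mh h01 x01); last 2 first.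
  + move=> t t01 tx.
    have U0 : U !=set0.
      apply/set0P/negP => /eqP U0; move: tx; rewrite U0 sup0.
      by case/andP: t01 => /ltW; rewrite leNgt => /negbTE ->.
    have [s [s01 cs] ts] := sup_gt U0 tx.
    by apply: (le_trans cs); apply: nh; rewrite ?in_itv//; exact: ltW.
  + move=> t t01 xt; rewrite leNgt; apply/negP => ct.
    move: xt; rewrite ltNge => /negP; apply; apply: ub_le_sup => //.
    by split => //; exact: ltW.
  (* The same cut bounds the potential of [h'] from below, so only the integrals up to the cut
     remain to be compared. The cuts 0 and 1, outside the scope of [le_h], are settled by the empty
     interval and by equality of means. *)
  apply: le_trans (split_le_potential c mh' h'01 x01); rewrite eq_h.
  rewrite lerD2r lerD2r ler_pM2l//.
  move: x0; rewrite le_eqVlt => /predU1P[<-|x0].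
    by rewrite set_itvoo0 !Rintegral_set0.
  move: x1; rewrite le_eqVlt => /predU1P[->|x1]; first by rewrite eq_h.
  by apply: le_h; rewrite x0.
(* At the levels 0 and 1 the potentials are the mean and one minus the mean, so comparing them at
   both levels forces equal means. *)
- have pot0 (f : R -> R) : measurable_fun (`]0, 1[%classic : set (measurableTypeR R)) f ->
      (forall t, 0 < t < 1 -> 0 <= f t <= 1) ->
      \int[mu]_(t in `]0, 1[) `|f t - 0| = \int[mu]_(t in `]0, 1[) f t.
    move=> mf f01; rewrite (split_eq_potential mf f01 (x := 1)) ?ler01 ?lexx//.
    + by rewrite mul0r addr0; lra.
    + by move=> t /f01 /andP[].
    + by move=> t /andP[_ /ltW]; rewrite leNgt => /negbTE ->.
  have pot1 (f : R -> R) : measurable_fun (`]0, 1[%classic : set (measurableTypeR R)) f ->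
      (forall t, 0 < t < 1 -> 0 <= f t <= 1) ->
      \int[mu]_(t in `]0, 1[) `|f t - 1| = 1 - \int[mu]_(t in `]0, 1[) f t.
    move=> mf f01; rewrite (split_eq_potential mf f01 (x := 0)) ?ler01 ?lexx//.
    + by rewrite set_itvoo0 Rintegral_set0; lra.
    + by move=> t /andP[/ltW]; rewrite leNgt => /negbTE ->.
    + by move=> t /f01 /andP[].
  have eq_h : \int[mu]_(t in `]0, 1[) h t = \int[mu]_(t in `]0, 1[) h' t.
    have := le_pot 1; rewrite !pot1// lerD2l lerN2 => h1.
    by apply/eqP; rewrite eq_le h1 -(pot0 h)// -(pot0 h')// le_pot.
  split => // x x01.
  have x01' : 0 <= x <= 1 by case/andP: x01 => /ltW -> /ltW ->.
  (* At the level [h' x] the bound with cut [x] is an equality for the decreasing function [h']. *)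
  have := le_trans (split_le_potential (h' x) mh h01 x01') (le_pot (h' x)).
  rewrite (split_eq_potential mh' h'01 x01'); last 2 first.
  + by move=> t t01 tx; apply: nh'; rewrite ?in_itv//; exact: ltW.
  + by move=> t t01 tx; apply: nh'; rewrite ?in_itv//; exact: ltW.
  by rewrite eq_h lerD2r lerD2r ler_pM2l.
Qed.

Lemma Rintegral_unif01 (f : R -> R) : measurable_fun setT f ->
  (forall t, 0 <= f t) ->
  \int[@unif01 R]_t f t = \int[mu]_(t in `]0, 1[) f t.
Proof.
move=> mf f0; rewrite /Rintegral; congr fine.
(* The identity carries Lebesgue measure from [measurableTypeR R] to [R] as a pushforward. *)
have mid : measurable_fun [set: measurableTypeR R] (idfun : measurableTypeR R -> R).
  exact: measurable_id.
rewrite (@ge0_negligible_integral _ _ _ (@unif01 R) setT (~` `]0, 1[%classic))//=.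
- rewrite setTD setCK -(ge0_integral_pushforward mid mu
    (D := `]0, 1[%classic : set R) (f := EFin \o f))//.
  + apply: eq_measure_integral => A mA A01.
    by rewrite [LHS]unif01E setIidl.
  + by apply/measurable_EFinP; exact: measurable_funTS.
  + by move=> t _; rewrite lee_fin.
- exact: measurableC.
- exact/measurable_EFinP.
- by move=> t _; rewrite lee_fin.
- by rewrite [LHS]unif01E setICl measure0.
Qed.

End schur_potential.

(** * Decreasing rearrangements of variables with values in [0,1] *)

Section rearrangement.
Context d (T : measurableType d) (R : realType) (P : probability T R).
Context (S : T -> R) (mS : measurable_fun setT S) (S01 : forall w, 0 <= S w <= 1).
Context (k : nat) (f : k.-tuple R -> R).
Hypothesis law_f : forall w,
  lebesgue_tuple R k (@open_cube R k `&` [set u | w <= f u]) = P [set a | w <= S a].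
Local Notation mu := (@lebesgue_measure R).
Local Notation hs := (decr_rearrangement f).

(** Existence is what has to be shown. The witness is [t |-> - q(t)] with [q] the quantile function
    of [- S]: then [w <= - q(t)] means [t <= P(- S <= - w) = P(w <= S)]. *)
Lemma decr_rearrangementP : is_decr_rearrangement f hs.
Proof.
apply: (@xgetPex _ (fun=> 0) [set h | is_decr_rearrangement f h]).
have mN : measurable_fun setT (\- S) by exact: measurable_funN.
pose Y : {RV P >-> R} := HB.pack (\- S) (@isMeasurableFun.Build _ _ _ _ (\- S) mN).
exists (fun t => - RV_quantile Y t); split.
  move=> t t'; rewrite !in_itv/= => t01 t'01 tt'.
  rewrite lerN2 quantile_le//; apply: (le_trans tt').
  exact: cdf_quantile_ge.
move=> w; rewrite law_f.
have F01 : 0 <= fine (cdf Y (- w)) <= 1.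
  rewrite fine_ge0//= -lee_fin fineK ?fin_num_measure//.
  exact: cdf_le1.
transitivity (unif01 [set v | v <= fine (cdf Y (- w))]).
  rewrite unif01E setIC; congr mu; apply/seteqP; split => t /= [h t01];
    split => //; move: t01; rewrite in_itv/= => t01.
    by rewrite -quantile_le// lerNr.
  by rewrite lerNr quantile_le.
rewrite unif01_le// fineK ?fin_num_measure//.
rewrite /cdf /distribution /pushforward; congr (P _).
by apply/seteqP; split => a /=; rewrite in_itv/= lerN2.
Qed.

Lemma decr_rearrangement_nonincreasing : {in `]0, 1[ &, nonincreasing_fun hs}.
Proof. by case: decr_rearrangementP. Qed.

Let hs_law w : mu (`]0, 1[ `&` [set t | w <= hs t]) = P [set a | w <= S a].
Proof. by case: decr_rearrangementP => _ ->. Qed.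

Let hs_itv w : measurable (`]0, 1[%classic `&` [set t : measurableTypeR R | w <= hs t]).
Proof.
apply: is_interval_measurable => s t /= [s01 ws] [t01 wt] u /andP[su ut].
have u01 : u \in `]0, 1[.
  move: s01 t01; rewrite !in_itv/= => /andP[s0 _] /andP[_ t1].
  by rewrite (lt_le_trans s0)//= (le_lt_trans ut).
by split=> //; apply: (le_trans wt); exact: decr_rearrangement_nonincreasing.
Qed.

Lemma decr_rearrangement_measurable :
  measurable_fun (`]0, 1[%classic : set (measurableTypeR R)) hs.
Proof.
apply: (measurability _ (RGenCInfty.measurableE R)) => _ [_ [w ->] <-].
rewrite [X in measurable X](_ : _ =
  `]0, 1[%classic `&` [set t : measurableTypeR R | w <= hs t]); first exact: hs_itv.
by apply/seteqP; split => t /=; rewrite !in_itv/= andbT.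
Qed.

(** The bounds hold at every point because monotonicity spreads a violation at [t] over an interval:
    a negative value leaves at most measure [t < 1] to the set [0 <= hs], and a value above 1 gives
    measure at least [t > 0] to a set that should be null. *)
Lemma decr_rearrangement_ge0_le1 t : 0 < t < 1 -> 0 <= hs t <= 1.
Proof.
move=> t01; have /andP[t0 t1] := t01.
have tI : t \in `]0, 1[ by rewrite in_itv.
apply/andP; split; rewrite leNgt; apply/negP => ht.
  have : (mu (`]0%R, 1%R[ `&` [set t | (0 <= hs t)%R]) <= mu `]0%R, t[%classic)%E.
    apply: le_measure; rewrite ?inE//; first exact: hs_itv.
    move=> u /= [u01 hu]; move: (u01); rewrite !in_itv/= => /andP[-> _] /=.
    rewrite ltNge; apply/negP => tu; move: ht; rewrite ltNge => /negP; apply.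
    by apply: (le_trans hu); exact: decr_rearrangement_nonincreasing.
  rewrite hs_law [X in P X](_ : _ = setT) ?probability_setT; last first.
    by rewrite -subTset => a _ /=; have /andP[] := S01 a.
  rewrite lebesgue_measure_itv/= lte_fin t0 oppr0 adde0 lee_fin.
  by rewrite leNgt t1.
have : (mu `]0%R, t]%classic <= mu (`]0%R, 1%R[ `&` [set u | (hs t <= hs u)%R]))%E.
  apply: le_measure; rewrite ?inE//; first exact: hs_itv.
  move=> u /=; rewrite !in_itv/= => /andP[u0 ut].
  have u01 : u \in `]0, 1[ by rewrite in_itv/= u0 (le_lt_trans ut).
  by split; [rewrite in_itv in u01|exact: decr_rearrangement_nonincreasing].
rewrite hs_law [X in P X](_ : _ = set0) ?measure0; last first.
  rewrite -subset0 => a /= hS; have /andP[_] := S01 a.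
  by rewrite leNgt (lt_le_trans ht).
by rewrite lebesgue_measure_itv/= lte_fin t0 oppr0 adde0 lee_fin leNgt t0.
Qed.

(** Under the uniform law [hs] has the law of [S], since the two agree on closed upper rays. *)
Lemma decr_rearrangement_potential c :
  \int[mu]_(t in `]0, 1[) `|hs t - c| = \int[P]_a `|S a - c|.
Proof.
(* Nothing is known of [hs] outside (0,1); the value 0 there makes it measurable on the whole
   line. *)
pose h t : R := if 0 < t < 1 then hs t else 0.
have mh : measurable_fun setT h.
  rewrite (_ : h = hs \_ `]0, 1[%classic).
    apply: (measurable_restrictT hs (measurable_itv `]0, 1[)).1.
    exact: decr_rearrangement_measurable.
  by apply/funext => t; rewrite patchE mem_setE in_itv.
pose H : {mfun R >-> R} := HB.pack h (@isMeasurableFun.Build _ _ _ _ h mh).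
pose S' : {mfun T >-> R} := HB.pack S (@isMeasurableFun.Build _ _ _ _ S mS).
have same_law A : measurable A -> distribution (@unif01 R) H A = distribution P S' A.
  apply: (@measure_eq_cray R (distribution (@unif01 R) H) (distribution P S')) => w.
  rewrite /distribution /pushforward /= unif01E.
  transitivity (mu (`]0%R, 1%R[ `&` [set t | w <= hs t])).
    rewrite setIC; congr mu; apply/seteqP; split => t /= [t01];
      by move: (t01); rewrite !in_itv/= /h andbT => -> ?; split.
  rewrite hs_law; congr (P _); apply/seteqP; split => a /=;
    by rewrite in_itv/= andbT.
have mc : measurable_fun setT (fun x : R => `|x - c|).
  by apply: measurableT_comp => //; exact: measurable_funB.
transitivity (\int[mu]_(t in `]0, 1[) `|h t - c|).
  by apply: eq_Rintegral => t; rewrite inE/= in_itv/= /h => ->.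
rewrite -(@Rintegral_unif01 R (fun t => `|h t - c|))//; last exact: measurableT_comp mc mh.
rewrite /Rintegral; congr fine.
transitivity (\int[distribution (@unif01 R) H]_x `|x - c|%:E)%E.
  rewrite ge0_integral_pushforward//.
  exact/measurable_EFinP.
rewrite (eq_measure_integral (distribution P S')); last first.
  by move=> A mA _; exact: same_law.
rewrite ge0_integral_pushforward//.
exact/measurable_EFinP.
Qed.

Lemma decr_rearrangement_integrable x : 0 <= x <= 1 ->
  mu.-integrable `]0, x[ (EFin \o hs).
Proof.
move=> /andP[x0 x1].
have xI : `]0, x[ `<=` (`]0, 1[%classic : set (measurableTypeR R)).
  by move=> t /=; rewrite !in_itv/= => /andP[-> tx]; exact: lt_le_trans tx x1.
apply: (@integrableS _ _ _ mu (`]0, 1[%classic : set (measurableTypeR R)) _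
  (EFin \o hs)) => //.
apply: measurable_bounded_integrable => //.
  by rewrite [X in (X < _)%E]lebesgue_measure_itv/= lte_fin ltr01 oppr0 adde0 ltry.
  exact: decr_rearrangement_measurable.
exists 1; split; first exact: num_real.
move=> z z1 t; rewrite /= in_itv/= => /decr_rearrangement_ge0_le1 /andP[h0 h1].
by rewrite ger0_norm// (le_trans h1)// ltW.
Qed.

End rearrangement.

Lemma schur_le_iff d d' (T : measurableType d) (T' : measurableType d')
    (R : realType) (P : probability T R) (P' : probability T' R)
    (S : T -> R) (S' : T' -> R) k k' (f : k.-tuple R -> R) (f' : k'.-tuple R -> R) :
  measurable_fun setT S -> (forall w, 0 <= S w <= 1) ->
  measurable_fun setT S' -> (forall w, 0 <= S' w <= 1) ->
  (forall w, lebesgue_tuple R k (@open_cube R k `&` [set u | w <= f u]) =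
    P [set a | w <= S a]) ->
  (forall w, lebesgue_tuple R k' (@open_cube R k' `&` [set u | w <= f' u]) =
    P' [set a | w <= S' a]) ->
  schur_le f f' <->
  forall c, \int[P]_a `|S a - c| <= \int[P']_a `|S' a - c|.
Proof.
move=> mS S01 mS' S'01 law_f law_f'.
have rw x : 0 <= x <= 1 ->
  (\int[lebesgue_measure]_(t in `]0%R, x[) (decr_rearrangement f t)%:E)%E =
  (\int[lebesgue_measure]_(t in `]0%R, x[) (decr_rearrangement f t))%:E.
  move=> x01; rewrite fineK//; apply: integrable_fin_num => //.
  exact: (decr_rearrangement_integrable mS S01 law_f x01).
have rw' x : 0 <= x <= 1 ->
  (\int[lebesgue_measure]_(t in `]0%R, x[) (decr_rearrangement f' t)%:E)%E =
  (\int[lebesgue_measure]_(t in `]0%R, x[) (decr_rearrangement f' t))%:E.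
  move=> x01; rewrite fineK//; apply: integrable_fin_num => //.
  exact: (decr_rearrangement_integrable mS' S'01 law_f' x01).
have i01 : 0 <= (1 : R) <= 1 by rewrite ler01 lexx.
apply: iff_trans; last first.
  apply: iff_trans.
    apply: (schur_le_potentialP
      (decr_rearrangement_nonincreasing mS law_f)
      (decr_rearrangement_nonincreasing mS' law_f')
      (decr_rearrangement_ge0_le1 mS S01 law_f)
      (decr_rearrangement_ge0_le1 mS' S'01 law_f')
      (decr_rearrangement_measurable mS law_f)
      (decr_rearrangement_measurable mS' law_f')).
  by split => h c; have := h c;
    rewrite (decr_rearrangement_potential mS law_f)
      (decr_rearrangement_potential mS' law_f').
rewrite /schur_le rw// rw'//; split => -[h1 h2]; split.
- move=> x x01; have := h1 x x01.
  by rewrite rw ?rw' ?lee_fin//; case/andP: x01 => /ltW -> /ltW ->.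
- by case: h2.
- move=> x x01; have := h1 x x01.
  by rewrite rw ?rw' ?lee_fin//; case/andP: x01 => /ltW -> /ltW ->.
- by rewrite h2.
Qed.

(** * Convex order and potentials *)

Section convex_function_line.
Context (R : realType) (phi : R^o -> R^o).
Hypothesis cvx : convex_function setT phi.

Lemma convex_functionP (a b x y : R) : 0 <= a -> 0 <= b -> a + b = 1 ->
  phi (a * x + b * y) <= a * phi x + b * phi y.
Proof.
move=> a0 b0 ab1.
have a1 : a <= 1 by rewrite -ab1 lerDl.
have -> : b = 1 - a by rewrite -ab1 addrAC subrr add0r.
exact: (@cvx (Itv01 a0 a1) x y (mem_set I) (mem_set I)).
Qed.

(** Clearing denominators in the three-point inequality lets it cover the degenerate case
    [x = z]. *)
Lemma convex_chord (x y z : R) : x <= y -> y <= z ->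
  (z - x) * phi y <= (z - y) * phi x + (y - x) * phi z.
Proof.
move=> xy yz; have [xz|xz] := ltP x z; last first.
  have xz' : x = z by apply/le_anti; rewrite (le_trans xy yz).
  have yz' : y = z by apply/le_anti; rewrite yz -xz'.
  by rewrite yz' xz' !subrr !mul0r addr0.
have d0 : 0 < z - x by rewrite subr_gt0.
have := @convex_functionP ((z - y) / (z - x)) ((y - x) / (z - x)) x z.
rewrite !divr_ge0 ?subr_ge0 ?(le_trans xy)// => /(_ isT isT).
rewrite -mulrDl addrA subrK divff ?gt_eqF// => /(_ erefl).
rewrite -(ler_pM2l d0); congr (_ <= _); last first.
  by field; rewrite gt_eqF.
by congr (_ * phi _); field; rewrite gt_eqF.
Qed.

(** Sublevel sets of a convex function are intervals. *)
Lemma convex_function_measurable : measurable_fun setT (phi : R -> R).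
Proof.
apply: (measurability _ (RGenInftyO.measurableE R)) => _ [_ [r ->] <-].
rewrite setTI; apply: is_interval_measurable => x y /=.
rewrite !in_itv/= => xr yr z /andP[xz zy]; rewrite in_itv/=.
rewrite ltNge; apply/negP => rz.
have := convex_chord xz zy; apply/negP; rewrite -ltNge.
have xz' : z != x by apply/negP => /eqP zx; move: rz; rewrite zx leNgt xr.
have {}xz : 0 < z - x by rewrite subr_gt0 lt_neqAle eq_sym xz'.
rewrite -subr_ge0 in zy.
have h1 : (y - z) * phi x <= (y - z) * phi z.
  by rewrite ler_wpM2l// (le_trans _ rz)// ltW.
have h2 : (z - x) * phi y < (z - x) * phi z.
  by rewrite ltr_pM2l// (lt_le_trans yr).
by move: h1 h2; rewrite !mulrBl; lra.
Qed.

Let B : R := `|phi 0| + `|phi 1| + 2 * `|phi 2^-1|.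

(** The upper bound comes from the chord over [0,1]; the lower one from convexity at the midpoint
    [2^-1] of [x] and [1 - x], with the upper bound at [1 - x]. *)
Lemma convex_function_bounded01 (x : R) : 0 <= x <= 1 -> `|phi x| <= B.
Proof.
have ub y : 0 <= y <= 1 -> phi y <= `|phi 0| + `|phi 1|.
  move=> /andP[y0 y1].
  have := @convex_functionP (1 - y) y 0 1; rewrite subr_ge0 => /(_ y1 y0).
  rewrite subrK mulr0 mulr1 add0r => /(_ erefl) /le_trans; apply.
  apply: lerD.
    apply: (le_trans (ler_norm _)); rewrite normrM ler_piMl//.
    by rewrite ger0_norm ?subr_ge0// gerBl.
  by apply: (le_trans (ler_norm _)); rewrite normrM ler_piMl// ger0_norm.
move=> x01; have ux := ub x x01.
have ux' : phi (1 - x) <= `|phi 0| + `|phi 1|.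
  by apply: ub; case/andP: x01 => ? ?; rewrite subr_ge0 gerBl; apply/andP.
have := @convex_functionP 2^-1 2^-1 x (1 - x).
have -> : 2^-1 * x + 2^-1 * (1 - x) = 2^-1 :> R by lra.
rewrite invr_ge0 ler0n => /(_ isT isT); have -> : 2^-1 + 2^-1 = 1 :> R by lra.
move=> /(_ erefl) h.
rewrite ler_norml; apply/andP; split; rewrite /B.
  have := ler_norm (- phi 2^-1); rewrite normrN; lra.
by have := normr_ge0 (phi 2^-1); lra.
Qed.

Let K : R := B + `|phi 2| + `|phi (-1)|.

(** Slopes inside [0,1] are compared with those of chords to the outer points 2 and -1. These lie at
    distance at least 1 from [0,1], so no denominator is small. *)
Lemma convex_function_lipschitz01 (x y : R) : 0 <= x -> x <= y -> y <= 1 ->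
  `|phi y - phi x| <= K * (y - x).
Proof.
move=> x0 xy y1.
have Bx : `|phi x| <= B by apply: convex_function_bounded01; rewrite x0 (le_trans xy).
have By : `|phi y| <= B by apply: convex_function_bounded01; rewrite y1 (le_trans x0).
have c1 : (2 - x) * (phi y - phi x) <= (y - x) * (phi 2 - phi x).
  have : (2 - x) * phi y <= (2 - y) * phi x + (y - x) * phi 2.
    by apply: convex_chord => //; lra.
  by lra.
have c2 : (y + 1) * (phi x - phi y) <= (y - x) * (phi (-1) - phi y).
  have : (y - -1) * phi x <= (y - x) * phi (-1) + (x - -1) * phi y.
    by apply: convex_chord => //; lra.
  by lra.
have d0 : 0 <= y - x by rewrite subr_ge0.
have K1 : phi 2 - phi x <= K.
  have := ler_norm (phi 2); have := ler_norm (- phi x); rewrite normrN /K.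
  by have := normr_ge0 (phi (-1)); lra.
have K2 : phi (-1) - phi y <= K.
  have := ler_norm (phi (-1)); have := ler_norm (- phi y); rewrite normrN /K.
  by have := normr_ge0 (phi 2); lra.
have K0 : 0 <= K.
  have := normr_ge0 (phi 2); have := normr_ge0 (phi (-1)).
  by have := normr_ge0 (phi x); rewrite /K; lra.
have Kd : 0 <= K * (y - x) by rewrite mulr_ge0.
have e1 : (y - x) * (phi 2 - phi x) <= K * (y - x).
  by rewrite mulrC ler_wpM2r.
have e2 : (y - x) * (phi (-1) - phi y) <= K * (y - x).
  by rewrite mulrC ler_wpM2r.
rewrite ler_norml; apply/andP; split.
  have [h|h] := leP (phi x - phi y) 0; first by lra.
  have : phi x - phi y <= (y + 1) * (phi x - phi y).
    by rewrite ler_peMl//; [exact: ltW|lra].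
  by lra.
have [h|h] := leP (phi y - phi x) 0; first by lra.
have : phi y - phi x <= (2 - x) * (phi y - phi x).
  by rewrite ler_peMl//; [exact: ltW|lra].
by lra.
Qed.

Definition pospart (t x : R) : R := Num.max (x - t) 0.

Section interpolation.
Context (n : nat) (n0 : (0 < n)%N).
Let e : R := n%:R^-1.
Let grid (j : nat) : R := j%:R * e.

Definition chord_slope (j : nat) : R := (phi (grid j.+1) - phi (grid j)) / e.

Let e_gt0 : 0 < e. Proof. by rewrite invr_gt0 ltr0n. Qed.

Let gridS j : grid j.+1 = grid j + e.
Proof. by rewrite /grid -natr1 mulrDl mul1r. Qed.

Let slopeE j : chord_slope j * e = phi (grid j.+1) - phi (grid j).
Proof. by rewrite /chord_slope divfK// gt_eqF. Qed.

Lemma chord_slope_nondecreasing j : chord_slope j <= chord_slope j.+1.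
Proof.
rewrite -(ler_pM2r e_gt0) !slopeE.
have := @convex_chord (grid j) (grid j.+1) (grid j.+2).
rewrite !gridS !lerDl (ltW e_gt0) => /(_ isT isT).
rewrite (_ : _ + e + e - grid j = e * 2); last by ring.
rewrite (_ : _ + e + e - _ = e); last by ring.
rewrite (_ : _ + e - _ = e); last by ring.
rewrite -mulrA -mulrDr ler_pM2l//.
by lra.
Qed.

(* Piecewise linear interpolation of [phi] on the grid, as a combination of
   hinge functions whose weights are the slopes of the chords. *)
Definition interpolate (m : nat) (x : R) : R :=
  phi 0 + \sum_(j < m) chord_slope j *
    (pospart (grid j) x - pospart (grid j.+1) x).

(** The second clause, constancy beyond [grid m], drives the induction: the new term vanishes up to
    [grid m] and then follows the next chord. The error [2 * K * e] is the variation of [phi] plus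
    that of the chord over one cell. *)
Lemma interpolateP m : (m <= n)%N ->
  (forall x, 0 <= x <= grid m -> phi x <= interpolate m x <= phi x + 2 * K * e) /\
  (forall x, grid m <= x -> interpolate m x = phi (grid m)).
Proof.
have K0 : 0 <= K.
  by rewrite /K /B !addr_ge0// mulr_ge0.
elim: m => [_|m ih mn].
  rewrite /interpolate; split => [x|x _]; rewrite big_ord0 addr0 /grid mul0r//.
  by move=> /le_anti <-; rewrite lexx lerDl !mulr_ge0// ltW.
have [ih1 ih2] := ih (ltnW mn).
have S x : interpolate m.+1 x = interpolate m x +
    chord_slope m * (pospart (grid m) x - pospart (grid m.+1) x).
  by rewrite /interpolate big_ord_recr/= addrA.
have gm0 : 0 <= grid m by rewrite mulr_ge0// ltW.
have gm1 : grid m.+1 <= 1.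
  by rewrite /grid /e ler_pdivrMr ?ltr0n// mul1r ler_nat.
have ge := gridS m.
split=> x; last first.
  move=> mx; rewrite S ih2; last by apply: le_trans mx; rewrite ge lerDl ltW.
  rewrite /pospart !max_l ?subr_ge0//; last by apply: le_trans mx; rewrite ge lerDl ltW.
  rewrite ge.
  rewrite (_ : x - grid m - (x - (grid m + e)) = e); last by ring.
  by rewrite slopeE ge; ring.
move=> /andP[x0 xm]; rewrite S; have [xgm|gmx] := leP x (grid m).
  rewrite /pospart !max_r ?subr_le0// subrr mulr0 addr0.
  by apply: ih1; rewrite x0.
rewrite ih2; last exact: ltW.
rewrite /pospart max_l ?subr_ge0 ?(ltW gmx)// max_r ?subr_le0// subr0.
have s1 : `|chord_slope m| <= K.
  rewrite -(ler_pM2r e_gt0) -{1}(gtr0_norm e_gt0) -normrM slopeE.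
  rewrite (_ : K * e = K * (grid m.+1 - grid m)); last by rewrite ge; ring.
  by apply: convex_function_lipschitz01; rewrite ?ge ?lerDl ?(ltW e_gt0)// -ge.
apply/andP; split.
  rewrite -(ler_pM2l e_gt0).
  have := convex_chord (ltW gmx) xm.
  rewrite {1}ge (_ : _ + e - _ = e); last by ring.
  move=> /le_trans; apply; rewrite mulrDr mulrA (mulrC e (chord_slope m)) slopeE.
  by rewrite ge le_eqVlt; apply/orP; left; apply/eqP; ring.
have xe : x - grid m <= e by rewrite lerBlDl -ge.
have h1 : phi (grid m) - phi x <= K * e.
  have := convex_function_lipschitz01 gm0 (ltW gmx) (le_trans xm gm1).
  rewrite distrC => /(le_trans (ler_norm _)) /le_trans; apply.
  by rewrite ler_wpM2l.
have h2 : chord_slope m * (x - grid m) <= K * e.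
  apply: (le_trans (ler_norm _)); rewrite normrM ler_pM//.
  by rewrite ger0_norm// subr_ge0 ltW.
by move: h1 h2; lra.
Qed.

End interpolation.

Lemma interpolate_approx (eps : R) : 0 < eps -> exists2 n : nat, (0 < n)%N &
  forall x, 0 <= x <= 1 -> phi x <= interpolate n n x <= phi x + eps.
Proof.
move=> e0; pose C := 2 * K.
have C0 : 0 <= C by rewrite /C /K /B mulr_ge0// !addr_ge0// mulr_ge0.
exists (Num.truncn (C / eps)).+1 => // x x01.
set n := (Num.truncn (C / eps)).+1; have n0 : 0 < n%:R :> R by rewrite ltr0n.
have [/(_ x) h _] := interpolateP (ltn0Sn _) (leqnn n).
move: h; rewrite divff ?gt_eqF// => /(_ x01) /andP[-> /le_trans] /=; apply.
rewrite lerD2l -/C ler_pdivrMr// -ler_pdivrMl// mulrC.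
have /truncn_itv/andP[_ /ltW] : 0 <= C / eps by rewrite divr_ge0// ltW.
exact.
Qed.

End convex_function_line.

Section potential.
Context d (T : measurableType d) (R : realType) (P : probability T R).
Context (S : T -> R) (mS : measurable_fun setT S) (S01 : forall w, 0 <= S w <= 1).

Let int_S : P.-integrable setT (EFin \o S).
Proof.
apply: (@bounded_measurable_integrable _ _ _ P S 1) => // w.
by have /andP[S0 S1] := S01 w; rewrite ger0_norm.
Qed.

Let int_cst r : P.-integrable setT (EFin \o cst r).
Proof. exact: finite_measure_integrable_cst. Qed.

Let Rint_cst r : \int[P]_w r = r.
Proof. by rewrite Rintegral_cst// [X in fine X]probability_setT mulr1. Qed.

Lemma potential_integrable c : P.-integrable setT (EFin \o (fun w => `|S w - c|)).
Proof. exact: (integrable_norm (integrableB measurableT int_S (int_cst c))). Qed.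

Lemma potential0 : \int[P]_w `|S w - 0| = \int[P]_w S w.
Proof.
by apply: eq_Rintegral => w _; have /andP[S0 S1] := S01 w; rewrite subr0 ger0_norm.
Qed.

Lemma potential1 : \int[P]_w `|S w - 1| = 1 - \int[P]_w S w.
Proof.
rewrite -[X in X - _]Rint_cst -(RintegralB measurableT (int_cst 1) int_S).
apply: eq_Rintegral => w _; have /andP[S0 S1] := S01 w.
by rewrite ler0_norm ?opprB// subr_le0.
Qed.

Let pospartE t w : pospart t (S w) = 2^-1 * (`|S w - t| + (S w - t)).
Proof.
rewrite /pospart; have [h|h] := leP 0 (S w - t); last first.
  by rewrite ltr0_norm// addNr mulr0.
by rewrite ger0_norm//; lra.
Qed.

Let int_pre t : P.-integrable setT (EFin \o (fun w => `|S w - t| + (S w - t))).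
Proof.
exact: (integrableD measurableT (potential_integrable t)
  (integrableB measurableT int_S (int_cst t))).
Qed.

Lemma pospart_integrable t : P.-integrable setT (EFin \o (fun w => pospart t (S w))).
Proof.
rewrite (_ : _ \o _ = fun w => (2^-1)%:E * (`|S w - t| + (S w - t))%:E)%E.
  exact: (integrableZl measurableT 2^-1 (int_pre t)).
by apply/funext => w; rewrite /= pospartE.
Qed.

Lemma Rintegral_pospart t : \int[P]_w pospart t (S w) =
  2^-1 * (\int[P]_w `|S w - t| + (\int[P]_w S w - t)).
Proof.
under eq_Rintegral do rewrite pospartE.
rewrite (RintegralZl 2^-1 measurableT (int_pre t)).
rewrite (RintegralD measurableT (potential_integrable t)
  (integrableB measurableT int_S (int_cst t))).
by rewrite (RintegralB measurableT int_S (int_cst t)) Rint_cst.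
Qed.

Lemma interpolate_integrable (phi : R^o -> R^o) n m :
  P.-integrable setT (EFin \o (fun w => interpolate phi n m (S w))) /\
  \int[P]_w interpolate phi n m (S w) = phi 0 + \sum_(j < m) chord_slope phi n j *
    (\int[P]_w pospart (j%:R * n%:R^-1) (S w) -
     \int[P]_w pospart (j.+1%:R * n%:R^-1) (S w)).
Proof.
elim: m => [|m [ih1 ih2]].
  rewrite big_ord0 addr0 /interpolate; split.
    by under eq_fun do rewrite big_ord0 addr0; exact: int_cst.
  by under eq_Rintegral do rewrite big_ord0 addr0; exact: Rint_cst.
pose s := chord_slope phi n m.
pose r w := pospart (m%:R * n%:R^-1) (S w) - pospart (m.+1%:R * n%:R^-1) (S w).
have e w : interpolate phi n m.+1 (S w) = interpolate phi n m (S w) + s * r w.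
  by rewrite /interpolate big_ord_recr /= addrA.
have ir : P.-integrable setT (EFin \o r).
  exact: (integrableB measurableT (pospart_integrable _) (pospart_integrable _)).
have isr : P.-integrable setT (EFin \o (fun w => s * r w)).
  exact: (integrableZl measurableT s ir).
split.
  rewrite (_ : _ \o _ = fun w => ((interpolate phi n m (S w))%:E + (s * r w)%:E)%E).
    exact: (integrableD measurableT ih1 isr).
  by apply/funext => w; rewrite /= e.
under eq_Rintegral do rewrite e.
rewrite (RintegralD measurableT ih1 isr) ih2 (RintegralZl s measurableT ir).
rewrite (RintegralB measurableT (pospart_integrable _) (pospart_integrable _)).
by rewrite big_ord_recr /= addrA.
Qed.

Lemma convex_comp_integrable (phi : R^o -> R^o) : convex_function setT phi ->
  P.-integrable setT (EFin \o (phi \o S)).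
Proof.
move=> cvx; apply: (@bounded_measurable_integrable _ _ _ P (phi \o S) _ _ _).
  exact: measurableT_comp (convex_function_measurable cvx) mS.
by move=> w; exact: convex_function_bounded01 (S01 w).
Qed.

Lemma expectation_convex (phi : R^o -> R^o) : convex_function setT phi ->
  'E_P[phi \o S]%E = (\int[P]_w phi (S w))%:E.
Proof.
move=> cvx; rewrite unlock fineK//; apply: integrable_fin_num => //.
exact: convex_comp_integrable.
Qed.

End potential.

Section convex_order.
Context d d' (T : measurableType d) (T' : measurableType d') (R : realType).
Context (P : probability T R) (P' : probability T' R).
Context (S : T -> R) (S' : T' -> R).
Hypotheses (mS : measurable_fun setT S) (S01 : forall w, 0 <= S w <= 1).
Hypotheses (mS' : measurable_fun setT S') (S'01 : forall w, 0 <= S' w <= 1).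

(** Summation by parts: increments of [s] multiply the nonnegative [a j], and only the boundary term
    at [m.+1] can be negative. *)
Lemma abel_sum_ge (s a : nat -> R) m :
  (forall j, s j <= s j.+1) -> a 0 = 0 -> (forall j, 0 <= a j) ->
  - (s m * a m.+1) <= \sum_(j < m.+1) s j * (a j - a j.+1).
Proof.
move=> ns a0 a_ge0; elim: m => [|m ih].
  by rewrite big_ord_recr big_ord0/= a0 add0r sub0r mulrN.
rewrite big_ord_recr/=; apply: le_trans (lerD ih (lexx _)).
have : 0 <= (s m.+1 - s m) * a m.+1 by rewrite mulr_ge0// subr_ge0.
by lra.
Qed.

Lemma abs_convex (c : R) : convex_function setT (fun x : R^o => `|x - c| : R^o).
Proof.
move=> t x y _ _; rewrite !convRE.
have a0 : 0 <= t%:num :> R by [].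
have a1 : 0 <= 1 - t%:num :> R by rewrite subr_ge0.
rewrite -[leLHS]/(`|t%:num * (x : R) + (1 - t%:num) * (y : R) - c|).
rewrite -[leRHS]/(t%:num * `|(x : R) - c| + (1 - t%:num) * `|(y : R) - c|).
move: (t%:num : R) a0 a1 => a a0 a1.
rewrite -[X in X * `|x - c|](ger0_norm a0) -[X in X * `|y - c|](ger0_norm a1).
rewrite -!normrM; apply: le_trans (ler_normD _ _).
by rewrite le_eqVlt; apply/orP; left; apply/eqP; congr `|_|; ring.
Qed.

Lemma potential_mean_eq :
  (forall c, \int[P]_w `|S w - c| <= \int[P']_w `|S' w - c|) ->
  \int[P]_w S w = \int[P']_w S' w.
Proof.
move=> le_pot; have := le_pot 1; have := le_pot 0.
by rewrite !potential0// !potential1//; lra.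
Qed.

(** In one direction [|x - c|] is a convex test function. In the other, [phi] is replaced up to
    [eps] by its interpolation, whose expectation is a combination of hinge expectations, hence of
    potentials and means. *)
Lemma convex_le_potentialP : convex_le P P' S S' <->
  forall c, \int[P]_w `|S w - c| <= \int[P']_w `|S' w - c|.
Proof.
split=> [cx c|le_pot phi cvx].
  have := cx _ (abs_convex c).
  by rewrite !expectation_convex//; exact: abs_convex.
rewrite !expectation_convex// lee_fin.
have eq_mean := potential_mean_eq le_pot.
apply/ler_addgt0Pr => eps e0.
have [n n0 L] := interpolate_approx cvx e0.
have [iS ES] := interpolate_integrable P mS S01 phi n n.
have [iS' ES'] := interpolate_integrable P' mS' S'01 phi n n.
have i1 := convex_comp_integrable P mS S01 cvx.
have i2 := convex_comp_integrable P' mS' S'01 cvx.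
have ic : P'.-integrable setT (EFin \o cst eps).
  exact: finite_measure_integrable_cst.
apply: (@le_trans _ _ (\int[P]_w interpolate phi n n (S w))).
  by apply: le_Rintegral => // w _; have /andP[] := L _ (S01 w).
apply: (@le_trans _ _ (\int[P']_w interpolate phi n n (S' w))); last first.
  have -> : \int[P']_w phi (S' w) + eps = \int[P']_w (phi (S' w) + eps).
    rewrite (RintegralD measurableT i2 ic).
    by rewrite Rintegral_cst// [X in fine X]probability_setT mulr1.
  apply: le_Rintegral => //.
    exact: (integrableD measurableT i2 ic).
  by move=> w _; have /andP[] := L _ (S'01 w).
rewrite ES ES' lerD2l -subr_ge0 -sumrB.
(* Gaps between hinge expectations: nonnegative by comparison of potentials, and 0 at both ends of
   the grid because there a hinge expectation depends on the mean alone. *)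
pose a j := \int[P']_w pospart (j%:R * n%:R^-1) (S' w) -
  \int[P]_w pospart (j%:R * n%:R^-1) (S w).
have a_ge0 j : 0 <= a j.
  rewrite /a !Rintegral_pospart// eq_mean -mulrBr mulr_ge0//.
  by have := le_pot (j%:R * n%:R^-1); lra.
have a0 : a 0 = 0.
  by rewrite /a !Rintegral_pospart// eq_mean mul0r !potential0// eq_mean subrr.
have an : a n = 0.
  rewrite /a divff ?pnatr_eq0 ?gtn_eqF// !Rintegral_pospart// !potential1//.
  by rewrite eq_mean; lra.
move: n0 a_ge0 a0 an; case: n {L ES ES' iS iS'} @a => // n a _ a_ge0 a0 an.
have := abel_sum_ge n (@chord_slope_nondecreasing _ phi cvx n.+1 (ltn0Sn n)) a0 a_ge0.
rewrite an mulr0 oppr0 => /le_trans; apply.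
rewrite le_eqVlt; apply/orP; left; apply/eqP; apply: eq_bigr => j _.
by rewrite -mulrBr /a; congr (_ * _); lra.
Qed.

End convex_order.

(** * Passing between the events A_v and B_v *)

Section quantile_levels.
Context d (T : measurableType d) (R : realType) (P : probability T R).
Variable Y : {RV P >-> R}.
Local Notation q := (RV_quantile Y).

Definition prob_lt_quantile v := fine (P [set w | Y w < q v]).
Definition prob_le_quantile v := fine (P [set w | Y w <= q v]).
Local Notation phi := prob_lt_quantile.
Local Notation psi := prob_le_quantile.

Lemma measurable_rv_le r : measurable [set w | Y w <= r].
Proof.
rewrite (_ : mkset _ = Y @^-1` `]-oo, r]); first exact: measurable_funPTI.
by apply/seteqP; split => w /=; rewrite in_itv.
Qed.

Lemma measurable_rv_lt r : measurable [set w | Y w < r].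
Proof.
rewrite (_ : mkset _ = Y @^-1` `]-oo, r[); first exact: measurable_funPTI.
by apply/seteqP; split => w /=; rewrite in_itv.
Qed.

Lemma measurable_rv_ge r : measurable [set w | r <= Y w].
Proof.
rewrite (_ : mkset _ = Y @^-1` `[r, +oo[); first exact: measurable_funPTI.
by apply/seteqP; split => w /=; rewrite in_itv/= andbT.
Qed.

Let fine_le_measure (A B : set T) : measurable A -> measurable B -> A `<=` B ->
  fine (P A) <= fine (P B).
Proof.
by move=> mA mB AB; rewrite fine_le ?fin_num_measure// le_measure ?inE.
Qed.

Lemma prob_le_quantileE v : psi v = fine (cdf Y (q v)).
Proof.
by rewrite /psi /cdf /distribution /pushforward; congr (fine (P _)).
Qed.

Lemma prob_ge_quantile v : fine (P [set w | q v <= Y w]) = 1 - phi v.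
Proof.
rewrite (_ : mkset _ = ~` [set w | Y w < q v]); last first.
  by apply/seteqP; split => w /= h;
    [apply/negP; rewrite -leNgt|rewrite leNgt; apply/negP].
rewrite probability_setC; last exact: measurable_rv_lt.
by rewrite fineB ?fin_num_measure//; exact: measurable_rv_lt.
Qed.

Lemma prob_gt_quantile v : fine (P (~` [set w | Y w <= q v])) = 1 - psi v.
Proof.
rewrite probability_setC; last exact: measurable_rv_le.
by rewrite fineB ?fin_num_measure//; exact: measurable_rv_le.
Qed.

Lemma prob_lt_quantile_ge0 v : 0 <= phi v. Proof. exact: fine_ge0. Qed.

Lemma prob_le_quantile_le1 v : psi v <= 1.
Proof.
rewrite -lee_fin fineK; last exact/fin_num_measure/measurable_rv_le.
exact/probability_le1/measurable_rv_le.
Qed.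

Lemma prob_lt_le_quantile v w : q v < q w -> psi v <= phi w.
Proof.
move=> qvw; apply: fine_le_measure => [||a /= h].
- exact: measurable_rv_le.
- exact: measurable_rv_lt.
- exact: le_lt_trans qvw.
Qed.

Lemma prob_lt_quantile_homo v w : q v <= q w -> phi v <= phi w.
Proof.
move=> qvw; apply: fine_le_measure => [||a /= h]; try exact: measurable_rv_lt.
exact: lt_le_trans qvw.
Qed.

Lemma le_prob_le_quantile v : 0 < v < 1 -> v <= psi v.
Proof. by move=> v01; rewrite prob_le_quantileE cdf_quantile_ge. Qed.

Lemma quantile_leE v w : 0 < v < 1 -> (q v <= q w) = (v <= psi w).
Proof. by move=> v01; rewrite quantile_le// prob_le_quantileE. Qed.

(** The event is the increasing union of the events [Y <= q v - 1/(n+1)], each of probability less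
    than [v] by [quantile_le]. *)
Lemma prob_lt_quantile_le v : 0 < v < 1 -> phi v <= v.
Proof.
move=> v01.
pose E n := [set w | Y w <= q v - n.+1%:R^-1].
have mE n : measurable (E n) by exact: measurable_rv_le.
have EU : \bigcup_n E n = [set w | Y w < q v].
  apply/seteqP; split => w /=.
    move=> [n _]; rewrite /E /= => /le_lt_trans; apply.
    by rewrite ltrBlDr ltrDl invr_gt0.
  move=> /ltr_add_invr[n h]; exists n => //.
  by rewrite /E /= lerBrDr ltW.
have ndE : nondecreasing_seq E.
  move=> n m nm; apply/subsetPset => w; rewrite /E /= => /le_trans; apply.
  by rewrite lerD2l lerN2 lef_pV2 ?posrE// ler_nat.
have mU : measurable (\bigcup_n E n) by exact: bigcupT_measurable.
have := nondecreasing_cvg_mu (mu := P) mE mU ndE; rewrite EU => cv.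
rewrite -lee_fin fineK; last exact/fin_num_measure/measurable_rv_lt.
rewrite -(cvg_lim _ cv)//; apply: lime_le.
  by apply/cvg_ex; eexists; exact: cv.
apply: nearW => n /=.
rewrite -[leLHS]fineK ?fin_num_measure// lee_fin leNgt; apply/negP => h.
have : q v <= q v - n.+1%:R^-1.
  by rewrite quantile_le//; exact: ltW h.
by rewrite lerBrDr gerDl leNgt invr_gt0 ltr0n.
Qed.

Lemma quantile_lt v w : 0 < w < 1 -> w < phi v -> q w < q v.
Proof.
move=> w01 wv; rewrite ltNge; apply/negP => /prob_lt_quantile_homo h.
by have := prob_lt_quantile_le w01; rewrite leNgt (lt_le_trans wv h).
Qed.

Lemma quantile_gt v w : 0 < w < 1 -> psi v < w -> q v < q w.
Proof. by move=> w01 vw; rewrite ltNge quantile_leE// -ltNge. Qed.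

Lemma ge_quantile_sub_gt v w : 0 < w < 1 -> psi v < w ->
  [set a | q w <= Y a] `<=` ~` [set a | Y a <= q v].
Proof.
move=> w01 vw a /= wa va; have := quantile_gt w01 vw.
by rewrite ltNge (le_trans wa va).
Qed.

(** The distance is [phi w - psi v], and [psi v <= phi w <= w]. *)
Lemma ge_quantile_gt_dist v w : 0 < w < 1 -> psi v < w ->
  `|fine (P (~` [set a | Y a <= q v])) - fine (P [set a | q w <= Y a])| <=
  w - psi v.
Proof.
move=> w01 vw; rewrite prob_gt_quantile prob_ge_quantile.
have h1 := prob_lt_quantile_le w01.
have h2 := prob_lt_le_quantile (quantile_gt w01 vw).
by rewrite ger0_norm; lra.
Qed.

Lemma gt_quantile_sup_ge v w : 0 < w < 1 -> w < phi v ->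
  [set a | q v <= Y a] `<=` ~` [set a | Y a <= q w].
Proof.
move=> w01 wv a /= va wa; have := quantile_lt w01 wv.
by rewrite ltNge (le_trans va wa).
Qed.

(** The distance is [phi v - psi w], and [w <= psi w <= phi v]. *)
Lemma gt_quantile_ge_dist v w : 0 < w < 1 -> w < phi v ->
  `|fine (P [set a | q v <= Y a]) - fine (P (~` [set a | Y a <= q w]))| <=
  phi v - w.
Proof.
move=> w01 wv; rewrite prob_gt_quantile prob_ge_quantile.
have h1 := le_prob_le_quantile w01.
have h2 := prob_lt_le_quantile (quantile_lt w01 wv).
by rewrite ler0_norm; lra.
Qed.

End quantile_levels.

Section same_levels.
Context d d' (T : measurableType d) (T' : measurableType d') (R : realType).
Context (P : probability T R) (P' : probability T' R).
Context (Y : {RV P >-> R}) (Y' : {RV P' >-> R}).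

(** For a rational [r] strictly between the two values, [v <= psi v <= phi r] on the first side,
    while [phi' r <= phi' v <= v] on the second; equality of [phi] and [phi'] at [r] closes the
    chain. Such levels [v] are therefore countably many. *)
Lemma prob_le_quantile_lt_rational v : 0 < v < 1 ->
  (forall w, 0 < w < 1 -> prob_lt_quantile Y w = prob_lt_quantile Y' w) ->
  prob_le_quantile Y v < prob_le_quantile Y' v ->
  exists r : rat, v = prob_lt_quantile Y (ratr r).
Proof.
move=> v01 eq_phi /rat_in_itvoo[r]; rewrite in_itv/= => /andP[vr rv]; exists r.
have r01 : 0 < (ratr r : R) < 1.
  have /andP[v0 v1] := v01.
  rewrite (lt_trans v0)//= ?(le_lt_trans (le_prob_le_quantile Y v01))//.
  exact: lt_le_trans rv (prob_le_quantile_le1 _ _).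
apply/le_anti/andP; split.
  apply: (le_trans (le_prob_le_quantile Y v01)).
  by apply/prob_lt_le_quantile/quantile_gt.
rewrite eq_phi//; apply: le_trans (prob_lt_quantile_le Y' v01).
by apply: prob_lt_quantile_homo; rewrite quantile_leE// ltW.
Qed.

(** Otherwise some [w] with [psi w = psi' w] lies strictly between [phi' v] and [phi v]. Then
    [w < phi v] gives [psi w < v], while [phi' v < w] gives [v <= psi' w]. *)
Lemma prob_lt_quantile_le_of_dense v : 0 < v < 1 ->
  (forall a b, 0 <= a -> a < b -> b <= 1 -> exists2 w, a < w < b &
    prob_le_quantile Y w = prob_le_quantile Y' w) ->
  prob_lt_quantile Y v <= prob_lt_quantile Y' v.
Proof.
move=> v01 dense; rewrite leNgt; apply/negP => lt_phi.
have v1 : prob_lt_quantile Y v <= 1.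
  by apply: (le_trans (prob_lt_quantile_le Y v01)); case/andP: v01 => _ /ltW.
have [w /andP[w1 w2] eq_psi] := dense _ _ (prob_lt_quantile_ge0 Y' v) lt_phi v1.
have w01 : 0 < w < 1.
  by rewrite (le_lt_trans (prob_lt_quantile_ge0 Y' v))//= (lt_le_trans w2).
have : prob_le_quantile Y w < v.
  by rewrite ltNge -quantile_leE// -ltNge; exact: quantile_lt.
rewrite eq_psi; apply/negP; rewrite -leNgt -quantile_leE// leNgt; apply/negP.
move=> /prob_lt_le_quantile h.
by have := le_prob_le_quantile Y' w01; rewrite leNgt (le_lt_trans h w1).
Qed.

End same_levels.

(** * Null sets, stability of potentials, and versions with values in [0,1] *)

Section almost_everywhere.
Context d (T : measurableType d) (R : realType) (P : probability T R).

Lemma measure_ae_eq (A B : set T) : measurable A -> measurable B ->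
  {ae P, forall w, A w <-> B w} -> P A = P B.
Proof.
move=> mA mB AB; rewrite -[A]setIT -[B]setIT -!integral_indic//.
apply: ae_eq_integral => //.
- exact/measurable_EFinP/measurable_indic.
- exact/measurable_EFinP/measurable_indic.
apply: filterS AB => w [h1 h2] _; rewrite !indicE; congr (_%:R%:E).
by congr nat_of_bool; apply/idP/idP => /set_mem ?; apply/mem_set; [exact: h1|exact: h2].
Qed.

Lemma expectation_ae_eq (X Z : T -> R) : measurable_fun setT X ->
  measurable_fun setT Z -> {ae P, forall w, X w = Z w} -> 'E_P[X]%E = 'E_P[Z]%E.
Proof.
move=> mX mZ XZ; rewrite unlock; apply: ae_eq_integral => //.
- exact/measurable_EFinP.
- exact/measurable_EFinP.
- by apply: filterS XZ => w ->.
Qed.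

End almost_everywhere.

Lemma potential_dist d (T : measurableType d) (R : realType)
    (P : probability T R) (S S1 : T -> R) c :
  measurable_fun setT S -> (forall w, 0 <= S w <= 1) ->
  measurable_fun setT S1 -> (forall w, 0 <= S1 w <= 1) ->
  \int[P]_w `|S w - c| <= \int[P]_w `|S1 w - c| + \int[P]_w `|S w - S1 w|.
Proof.
move=> mS S01 mS1 S101.
have i1 := potential_integrable P mS1 S101 c.
have i0 := potential_integrable P mS S01 c.
have i2 : P.-integrable setT (EFin \o (fun w => `|S w - S1 w|)).
  apply: (@bounded_measurable_integrable _ _ _ P _ 1).
    by apply: measurableT_comp => //; exact: measurable_funB.
  move=> w; rewrite normr_id ler_norml.
  by have /andP[? ?] := S01 w; have /andP[? ?] := S101 w; apply/andP; split; lra.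
rewrite -(RintegralD measurableT i1 i2); apply: le_Rintegral => //.
  exact: (integrableD measurableT i1 i2).
move=> w _; rewrite (_ : S w - c = (S1 w - c) + (S w - S1 w)); last by lra.
exact: ler_normD.
Qed.

Lemma potential_onem d (T : measurableType d) (R : realType)
    (P : probability T R) (S : T -> R) c :
  \int[P]_w `|1 - S w - c| = \int[P]_w `|S w - (1 - c)|.
Proof.
by apply: eq_Rintegral => w _; rewrite -normrN; congr `|_|; lra.
Qed.

Section almost_every_level.
Context (R : realType).

Lemma ae_lebesgue_dense (G : R -> Prop) :
  {ae @lebesgue_measure R, forall v, 0 < v < 1 -> G v} ->
  forall a b, 0 <= a -> a < b -> b <= 1 -> exists2 w, a < w < b & G w.
Proof.
move=> [N [mN N0 sub]] a b a0 ab b1; apply: contrapT => noG.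
have : (@lebesgue_measure R `]a, b[%classic <= @lebesgue_measure R N)%E.
  apply: le_measure; rewrite ?inE//.
  move=> w /=; rewrite in_itv/= => wab; apply: (sub w) => /= h; apply: noG.
  exists w => //; apply: h; have /andP[aw wb] := wab.
  by rewrite (le_lt_trans a0)// (lt_le_trans wb).
rewrite N0 lebesgue_measure_itv/= lte_fin ab -EFinD lee_fin.
by rewrite leNgt subr_gt0 ab.
Qed.

Lemma ae_lebesgue_impl (G H : R -> Prop) : (forall v, 0 < v < 1 -> G v -> H v) ->
  {ae @lebesgue_measure R, forall v, 0 < v < 1 -> G v} ->
  {ae @lebesgue_measure R, forall v, 0 < v < 1 -> H v}.
Proof.
move=> GH [N [mN N0 sub]]; exists N; split => // v /= nH.
by apply: (sub v) => /= h; apply: nH => v01; exact: GH v01 (h v01).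
Qed.

Lemma ae_lebesgue_notin_countable (C : set R) (G : R -> Prop) : countable C ->
  (forall v, 0 < v < 1 -> ~ C v -> G v) ->
  {ae @lebesgue_measure R, forall v, 0 < v < 1 -> G v}.
Proof.
move=> cC CG; exists C; split.
- exact: countable_measurable.
- exact: countable_lebesgue_measure0.
- by move=> v /= h; apply: contrapT => nCv; apply: h => v01; exact: CG.
Qed.

End almost_every_level.

Lemma clip_unit (R : realType) d d' (T : measurableType d)
    (V : measurableType d') (X : {mfun T >-> V}) (h : V -> R) : measurable_fun setT h ->
  measurable_fun setT (fun w => clip01 (h (X w))) /\
  forall w, 0 <= clip01 (h (X w)) <= 1.
Proof.
move=> mh; split; last by move=> w; rewrite clip01_ge0 clip01_le1.
apply: measurable_maxr => //; apply: measurable_minr => //.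
exact: measurableT_comp.
Qed.

(** The transform of uniform levels has the law of [X], and clipping changes the version on a null
    set only; this is the law hypothesis of [schur_le_iff]. *)
Lemma mqt_cond_prob_law (R : realType) d (T : measurableType d)
    (P : probability T R) k (X : {RV P >-> k.-tuple R})
    (K : forall i, R.-pker i.-tuple R ~> R) (A : set T) (h : k.-tuple R -> R) :
  is_cond_dist X K -> measurable A -> is_cond_prob P A X h -> forall w : R,
  lebesgue_tuple R k (@open_cube R k `&` [set u | w <= (h \o mqt K (p:=k)) u]) =
  P [set a | w <= clip01 (h (X a))].
Proof.
move=> hK mA hh w; have [mh _ _] := hh.
have mC : measurable [set x | w <= h x].
  by rewrite -[X in measurable X]setTI; exact: measurable_fun_ler.
rewrite (mqt_law hK mC).
have mX : measurable_fun setT X by exact: measurable_funPT.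
have [_ ae_h] := is_cond_prob_clip mX mA hh.
apply: measure_ae_eq.
- by rewrite -[Z in measurable Z]setTI; exact: mX.
- rewrite -[Z in measurable Z]setTI; apply: measurable_fun_ler => //.
  by have [] := clip_unit X mh.
- by apply: filterS ae_h => a /= ->.
Qed.

Section unit_versions.
Context (R : realType) d d' (T : measurableType d) (V : measurableType d').
Context (P : probability T R) (X : {RV P >-> V}).

Let mX : measurable_fun setT X. Proof. exact: measurable_funPT. Qed.

Lemma unit_version_exists A : measurable A ->
  exists h, is_cond_prob P A X h /\ forall x, 0 <= h x <= 1.
Proof.
move=> mA; have [h hh] := @is_cond_prob_exists _ _ _ _ _ P A X mA.
exists (@clip01 R \o h); split; first by have [] := is_cond_prob_clip mX mA hh.
by move=> x; rewrite clip01_ge0 clip01_le1.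
Qed.

(** Potentials move by at most the L^1 distance of the versions, which for nested events is the
    difference of the probabilities. *)
Lemma unit_version_potential_le C C1 h h1 c eps : measurable C -> measurable C1 ->
  C `<=` C1 \/ C1 `<=` C -> `|fine (P C) - fine (P C1)| <= eps ->
  is_cond_prob P C X h -> is_cond_prob P C1 X h1 ->
  (forall x, 0 <= h x <= 1) -> (forall x, 0 <= h1 x <= 1) ->
  \int[P]_w `|h (X w) - c| <= \int[P]_w `|h1 (X w) - c| + eps.
Proof.
move=> mC mC1 CC1 dC hh hh1 h01 h101.
have mh := is_cond_prob_measurable mX hh.
have mh1 := is_cond_prob_measurable mX hh1.
apply: (le_trans (@potential_dist _ _ _ P (h \o X) (h1 \o X) c _ _ _ _)).
- exact: mh.
- by move=> w; exact: h01.
- exact: mh1.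
- by move=> w; exact: h101.
rewrite lerD2l; apply: le_trans dC; case: CC1 => CC1.
  under eq_Rintegral do rewrite distrC.
  by rewrite (is_cond_prob_dist mX mC mC1 CC1 hh hh1) -normrN opprB ler_norm.
by rewrite (is_cond_prob_dist mX mC1 mC CC1 hh1 hh) ler_norm.
Qed.

End unit_versions.

(** * The two implications in terms of conditional potentials *)

Section conditional_potentials.
Context (R : realType) (d d' : measure_display).
Context (T : measurableType d) (T' : measurableType d').
Context (P : probability T R) (P' : probability T' R) (p p' : nat).
Context (Y : {RV P >-> R}) (X : {RV P >-> p.-tuple R}).
Context (Y' : {RV P' >-> R}) (X' : {RV P' >-> p'.-tuple R}).

Let mX : measurable_fun setT X. Proof. exact: measurable_funPT. Qed.
Let mX' : measurable_fun setT X'. Proof. exact: measurable_funPT. Qed.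

Let A v := [set a | RV_quantile Y v <= Y a].
Let A' v := [set a | RV_quantile Y' v <= Y' a].
Let B v := ~` [set a | Y a <= RV_quantile Y v].
Let B' v := ~` [set a | Y' a <= RV_quantile Y' v].

Let mA v : measurable (A v). Proof. exact: measurable_rv_ge. Qed.
Let mA' v : measurable (A' v). Proof. exact: measurable_rv_ge. Qed.
Let mB v : measurable (B v).
Proof. by apply: measurableC; exact: measurable_rv_le. Qed.
Let mB' v : measurable (B' v).
Proof. by apply: measurableC; exact: measurable_rv_le. Qed.

Definition cond_potential_le (C : set T) (C' : set T') :=
  forall h h', is_cond_prob P C X h -> is_cond_prob P' C' X' h' ->
  (forall x, 0 <= h x <= 1) -> (forall x, 0 <= h' x <= 1) ->
  forall c, \int[P]_w `|h (X w) - c| <= \int[P']_w `|h' (X' w) - c|.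

Lemma cond_potential_le_mean C C' : measurable C -> measurable C' ->
  cond_potential_le C C' -> fine (P C) = fine (P' C').
Proof.
move=> mC mC' le_pot.
have [h [hh h01]] := unit_version_exists X mC.
have [h' [hh' h'01]] := unit_version_exists X' mC'.
rewrite -(is_cond_prob_mean hh) -(is_cond_prob_mean hh').
apply: (@potential_mean_eq _ _ _ _ _ P P' (h \o X) (h' \o X')).
- exact: is_cond_prob_measurable hh.
- by move=> w; exact: h01.
- exact: is_cond_prob_measurable hh'.
- by move=> w; exact: h'01.
- exact: le_pot.
Qed.

Lemma cond_convex_leP : cond_convex_le Y X Y' X' <->
  forall v, 0 < v < 1 -> cond_potential_le (A v) (A' v).
Proof.
split=> [ccx v v01 h h' hh hh' h01 h'01|le_pot v v01 h h' hh hh'].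
  apply/(@convex_le_potentialP _ _ _ _ _ P P' (h \o X) (h' \o X')).
  - exact: is_cond_prob_measurable hh.
  - by move=> w; exact: h01.
  - exact: is_cond_prob_measurable hh'.
  - by move=> w; exact: h'01.
  - exact: ccx v01 _ _ hh hh'.
have [hc ae_h] := is_cond_prob_clip mX (@mA v) hh.
have [hc' ae_h'] := is_cond_prob_clip mX' (@mA' v) hh'.
move=> phi cvx.
have mphi := convex_function_measurable cvx.
have mh := is_cond_prob_measurable mX hh.
have mh' := is_cond_prob_measurable mX' hh'.
have mhc := is_cond_prob_measurable mX hc.
have mhc' := is_cond_prob_measurable mX' hc'.
rewrite (@expectation_ae_eq _ _ _ P _ (phi \o (@clip01 R \o h \o X))); last 3 first.
- exact: measurableT_comp.
- exact: measurableT_comp.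
- by apply: filterS ae_h => w /= ->.
rewrite [leRHS](@expectation_ae_eq _ _ _ P' _
  (phi \o (@clip01 R \o h' \o X'))); last 3 first.
- exact: measurableT_comp.
- exact: measurableT_comp.
- by apply: filterS ae_h' => w /= ->.
move: phi cvx {mphi}; apply/convex_le_potentialP => //.
- by move=> w; rewrite clip01_ge0 clip01_le1.
- by move=> w; rewrite clip01_ge0 clip01_le1.
by apply: le_pot v01 _ _ hc hc' _ _ => x; rewrite clip01_ge0 clip01_le1.
Qed.

(** Half of [eps] is spent on passing from [C] to [D], the other half on passing from [D'] back to
    [C']. *)
Lemma cond_potential_le_approx C C' : measurable C -> measurable C' ->
  (forall eps, 0 < eps -> exists D D',
    [/\ cond_potential_le D D', measurable D /\ measurable D',
      C `<=` D \/ D `<=` C, C' `<=` D' \/ D' `<=` C' &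
      `|fine (P C) - fine (P D)| <= eps /\ `|fine (P' C') - fine (P' D')| <= eps]) ->
  cond_potential_le C C'.
Proof.
move=> mC mC' approx h h' hh hh' h01 h'01 c; apply/ler_addgt0Pr => eps e0.
have [|D [D' [le_D [mD mD'] CD CD' [dD dD']]]] := approx (eps / 2).
  by rewrite divr_gt0.
have [k [hk k01]] := unit_version_exists X mD.
have [k' [hk' k'01]] := unit_version_exists X' mD'.
have u1 := unit_version_potential_le c mC mD CD dD hh hk h01 k01.
have u2 := le_D _ _ hk hk' k01 k'01 c.
rewrite distrC in dD'.
have u3 : \int[P']_w `|k' (X' w) - c| <= \int[P']_w `|h' (X' w) - c| + eps / 2.
  apply: unit_version_potential_le hk' hh' k'01 h'01 => //.
  by case: CD'; [right|left].
by lra.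
Qed.

(** One pair of versions suffices: two versions for the same event are at L^1 distance 0. *)
Lemma cond_potential_le_intro C C' h h' : measurable C -> measurable C' ->
  is_cond_prob P C X h -> is_cond_prob P' C' X' h' ->
  (forall x, 0 <= h x <= 1) -> (forall x, 0 <= h' x <= 1) ->
  (forall c, \int[P]_w `|h (X w) - c| <= \int[P']_w `|h' (X' w) - c|) ->
  cond_potential_le C C'.
Proof.
move=> mC mC' hh hh' h01 h'01 le_pot k k' hk hk' k01 k'01 c.
have u1 : \int[P]_w `|k (X w) - c| <= \int[P]_w `|h (X w) - c| + 0.
  apply: unit_version_potential_le hk hh k01 h01 => //; first by left.
  by rewrite subrr normr0.
have u2 : \int[P']_w `|h' (X' w) - c| <= \int[P']_w `|k' (X' w) - c| + 0.
  apply: unit_version_potential_le hh' hk' h'01 k'01 => //; first by left.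
  by rewrite subrr normr0.
by have := le_pot c; lra.
Qed.

Lemma cond_potential_leC C C' : measurable C -> measurable C' ->
  cond_potential_le C C' -> cond_potential_le (~` C) (~` C').
Proof.
move=> mC mC' le_C h h' hh hh' h01 h'01 c.
have := is_cond_probC mX (measurableC mC) hh.
have := is_cond_probC mX' (measurableC mC') hh'.
rewrite !setCK => kk' kk; have := le_C _ _ kk kk' _ _ (1 - c).
rewrite !potential_onem subKr; apply => x.
  by have := h01 x; lra.
by have := h'01 x; lra.
Qed.

Lemma cond_potential_le_set0 : cond_potential_le set0 set0.
Proof.
apply: (cond_potential_le_intro (h := fun=> 0) (h' := fun=> 0)) => //.
- exact: is_cond_prob_set0.
- exact: is_cond_prob_set0.
- by move=> x; rewrite lexx ler01.
- by move=> x; rewrite lexx ler01.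
move=> c; rewrite !Rintegral_cst//.
by rewrite [X in fine X]probability_setT [X in _ <= _ * fine X]probability_setT.
Qed.

Lemma gt_quantile_potential_le :
  (forall v, 0 < v < 1 -> cond_potential_le (A v) (A' v)) ->
  {ae @lebesgue_measure R, forall v, 0 < v < 1 -> cond_potential_le (B v) (B' v)}.
Proof.
move=> le_A.
have eq_phi v : 0 < v < 1 -> prob_lt_quantile Y v = prob_lt_quantile Y' v.
  move=> v01; have := cond_potential_le_mean (@mA v) (@mA' v) (le_A v v01).
  by rewrite !prob_ge_quantile; lra.
(* The possible exceptional levels: values of [phi] and [phi'] at rationals, the boolean telling
   which of the two functions. *)
pose bad (br : bool * rat) : R :=
  if br.1 then prob_lt_quantile Y (ratr br.2) else prob_lt_quantile Y' (ratr br.2).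
apply: (@ae_lebesgue_notin_countable _ (range bad)).
  exact: sub_countable (card_image_le _ _) (countableP _).
move=> v v01 nbad.
have eq_psi : prob_le_quantile Y v = prob_le_quantile Y' v.
  apply/eqP; rewrite eq_le !leNgt; apply/andP; split; apply/negP => lt_psi; apply: nbad.
    have [//|r ->] := @prob_le_quantile_lt_rational _ _ _ _ _ _ _ Y' Y v v01 _ lt_psi.
      by move=> w w01; rewrite eq_phi.
    by exists (false, r).
  have [r ->] := prob_le_quantile_lt_rational v01 eq_phi lt_psi.
  by exists (true, r).
apply: cond_potential_le_approx => // eps e0.
(* If [psi v = 1] no level remains above it, but then [B v] and [B' v] are null and the empty events
   approximate them. *)
have := prob_le_quantile_le1 Y v; rewrite le_eqVlt => /predU1P[psi1|psi1].
  exists set0, set0; split; [exact: cond_potential_le_set0|by []|by right|by right|].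
  rewrite !measure0 !prob_gt_quantile -eq_psi psi1 !subrr normr0.
  by rewrite ltW.
have psi0 := le_prob_le_quantile Y v01.
have v0 : 0 < v by case/andP: v01.
pose s := prob_le_quantile Y v.
(* A level above [psi v] by at most [eps]; the midpoint with 1 keeps it below 1. *)
pose w := Num.min (s + eps) ((s + 1) / 2).
have sw : s < w by rewrite lt_min ltrDl e0 /=; move: psi1; rewrite /s; lra.
have ws : w - s <= eps by rewrite lerBlDl ge_min lexx.
have w1 : w < 1 by rewrite gt_min; apply/orP; right; move: psi1; rewrite /s; lra.
have w01 : 0 < w < 1 by rewrite w1 andbT (lt_trans v0)// (le_lt_trans psi0).
have sw' : prob_le_quantile Y' v < w by rewrite -eq_psi.
exists (A w), (A' w); split => //; first exact: le_A.
- by right; exact: ge_quantile_sub_gt.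
- by right; exact: ge_quantile_sub_gt.
split; first exact: le_trans (ge_quantile_gt_dist w01 sw) ws.
by apply: le_trans (ge_quantile_gt_dist w01 sw') _; rewrite -eq_psi.
Qed.

Lemma ge_quantile_potential_le :
  {ae @lebesgue_measure R, forall v, 0 < v < 1 -> cond_potential_le (B v) (B' v)} ->
  forall v, 0 < v < 1 -> cond_potential_le (A v) (A' v).
Proof.
move=> /ae_lebesgue_dense le_B v v01.
have dense a b : 0 <= a -> a < b -> b <= 1 -> exists2 w, a < w < b &
    prob_le_quantile Y w = prob_le_quantile Y' w.
  move=> a0 ab b1; have [w wab le_w] := le_B a b a0 ab b1; exists w => //.
  have := cond_potential_le_mean (@mB w) (@mB' w) le_w.
  by rewrite !prob_gt_quantile; lra.
have eq_phi : prob_lt_quantile Y v = prob_lt_quantile Y' v.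
  apply/le_anti/andP; split; first exact: prob_lt_quantile_le_of_dense.
  apply: prob_lt_quantile_le_of_dense => // a b a0 ab b1.
  by have [w wab e] := dense a b a0 ab b1; exists w.
apply: cond_potential_le_approx => // eps e0.
(* If [phi v = 0] no level remains below it, but then [A v] and [A' v] have probability 1 and the
   full events approximate them. *)
have := prob_lt_quantile_ge0 Y v; rewrite le_eqVlt => /predU1P[phi0|phi0].
  exists setT, setT; split.
  - have := cond_potential_leC measurable0 measurable0 cond_potential_le_set0.
    by rewrite !setC0.
  - by [].
  - by left.
  - by left.
  rewrite !prob_ge_quantile -eq_phi -phi0 [X in fine X]probability_setT.
  by rewrite [X in _ /\ `|_ - fine X| <= _]probability_setT/= !subr0 subrr normr0 ltW.
pose s := prob_lt_quantile Y v.
have s1 : s <= 1.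
  by apply: (le_trans (prob_lt_quantile_le Y v01)); case/andP: v01 => _ /ltW.
have [||//|w /andP[sw ws] le_w] := le_B (Num.max 0 (s - eps)) s.
- by rewrite le_max lexx.
- by rewrite gt_max phi0 gtrBl e0.
move: sw; rewrite gt_max => /andP[w0 sw].
have w01 : 0 < w < 1 by rewrite w0 (lt_le_trans ws).
have ws' : w < prob_lt_quantile Y' v by rewrite -eq_phi.
exists (B w), (B' w); split => //.
- by left; exact: gt_quantile_sup_ge.
- by left; exact: gt_quantile_sup_ge.
split.
  by apply: le_trans (gt_quantile_ge_dist w01 ws) _; move: sw; rewrite /s; lra.
apply: le_trans (gt_quantile_ge_dist w01 ws') _.
by move: sw; rewrite /s -eq_phi; lra.
Qed.

(** The function eta^v conditions on the complement of [B v]; taking complements reflects the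
    potentials by [c |-> 1 - c] and preserves their comparison. *)
Lemma schur_le_cond_potentialP (K : forall i, R.-pker i.-tuple R ~> R)
    (K' : forall i, R.-pker i.-tuple R ~> R) (g : R -> p.-tuple R -> R)
    (g' : R -> p'.-tuple R -> R) v :
  is_cond_dist X K -> is_cond_dist X' K' ->
  is_cond_cdf_at_quantiles Y X g -> is_cond_cdf_at_quantiles Y' X' g' ->
  0 < v < 1 ->
  schur_le (g v \o mqt K (p:=p)) (g' v \o mqt K' (p:=p')) <->
  cond_potential_le (B v) (B' v).
Proof.
move=> hK hK' hg hg' v01.
pose D := [set a | Y a <= RV_quantile Y v].
pose D' := [set a | Y' a <= RV_quantile Y' v].
have mD : measurable D by exact: measurable_rv_le.
have mD' : measurable D' by exact: measurable_rv_le.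
have hgv := hg v v01; have hgv' := hg' v v01.
have [hc _] := is_cond_prob_clip mX mD hgv.
have [hc' _] := is_cond_prob_clip mX' mD' hgv'.
have [mg _ _] := hgv; have [mg' _ _] := hgv'.
have [mS S01] := clip_unit X mg; have [mS' S'01] := clip_unit X' mg'.
rewrite (schur_le_iff mS S01 mS' S'01 (mqt_cond_prob_law hK mD hgv)
  (mqt_cond_prob_law hK' mD' hgv')).
split=> [le_pot|].
  apply: cond_potential_leC => //.
  by apply: (cond_potential_le_intro mD mD' hc hc' _ _ le_pot) => x;
    rewrite clip01_ge0 clip01_le1.
move=> /(cond_potential_leC (@mB v) (@mB' v)); rewrite !setCK => le_D.
by apply: (le_D _ _ hc hc') => x; rewrite clip01_ge0 clip01_le1.
Qed.

End conditional_potentials.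

Theorem theorem2p2 (R : realType) (d d' : measure_display)
    (T : measurableType d) (T' : measurableType d')
    (P : probability T R) (P' : probability T' R)
    (p p' : nat) (hp : (0 < p)%N) (hp' : (0 < p')%N)
    (Y : {RV P >-> R}) (X : {RV P >-> p.-tuple R})
    (Y' : {RV P' >-> R}) (X' : {RV P' >-> p'.-tuple R})
    (K : forall i, R.-pker i.-tuple R ~> R) (hK : is_cond_dist X K)
    (K' : forall i, R.-pker i.-tuple R ~> R) (hK' : is_cond_dist X' K')
    (g : R -> p.-tuple R -> R) (hg : is_cond_cdf_at_quantiles Y X g)
    (g' : R -> p'.-tuple R -> R) (hg' : is_cond_cdf_at_quantiles Y' X' g') :
  cond_convex_le Y X Y' X' <->
  {ae lebesgue_measure, forall v : R, 0 < v < 1 ->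
     schur_le (g v \o mqt K (p:=p)) (g' v \o mqt K' (p:=p'))}.
Proof.
have schurP v : 0 < v < 1 -> _ := @schur_le_cond_potentialP _ _ _ _ _ _ _ _ _
  Y X Y' X' K K' g g' v hK hK' hg hg'.
rewrite cond_convex_leP; split=> [/gt_quantile_potential_le|le_schur].
  by apply: ae_lebesgue_impl => v v01 le_B; apply/schurP.
apply: ge_quantile_potential_le.
by apply: ae_lebesgue_impl le_schur => v v01 /(schurP v v01).
Qed.
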